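(* Let $\mathbb{X}$ be a compact metric space, $f:\mathbb{X}\to\mathbb{X}$ continuous and $\mu$ a finite Borel measure on $\mathbb{X}$. Then $f$ admits a generalized $\mu$-physical measure if, and only if, $\mu(\{x\in\mathbb{X}:\eta_x(\mathbb{X})=1\})>0$. If, in addition, $\mu$ is ergodic (but not necessarily invariant), then $f$ admits a $\mu$-physical measure.
   Context: For $x\in\mathbb{X}$ and $A\subset\mathbb{X}$ let $\tau_x(A)=\limsup_{n\to\infty}\frac1n\sum_{j=0}^{n-1}\chi_A(f^jx)$. For $Y\subset\mathbb{X}$, $r>0$, let $\nu_r(Y)=\inf\sum_{I\in\mathcal I}\tau_x(I)$ over countable covers $\mathcal I$ of $Y$ by open sets of diameter $\le r$, $\nu(Y)=\sup_{r>0}\nu_r(Y)$, and $\eta_x=\nu$ restricted to Borel sets. An $f$-invariant measure $\nu$ is $\mu$-physical if there is $U$ with $\mu(U)>0$ such that $\lim_{n\to\infty}\frac1n\sum_{j=0}^{n-1}\varphi(f^jx)=\int\varphi\,d\nu$ for every continuous $\varphi$ and every $x\in U$. An $f$-invariant measure $\nu$ is generalized $\mu$-physical if there is $U$ with $\mu(U)>0$ such that for every continuous $\varphi$ the limit $\lim_n\frac1n\sum_{j=0}^{n-1}\varphi(f^jx)$ exists for $x\in U$ and $\int_U\big(\lim_n\frac1n\sum_{j=0}^{n-1}\varphi(f^jx)\big)d\mu(x)=\int\varphi\,d\nu$. A (not necessarily invariant) measure $\mu$ is ergodic if $\mu(U)=0$ or $\mu(\mathbb{X}\setminus U)=0$ for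 every Borel $U$ with $f^{-1}(U)=U$. *)

(* Defs.v *)
From HB Require Import structures.
From mathcomp Require Import all_boot all_order all_algebra.
From mathcomp Require Import all_classical all_reals all_analysis.
Set Implicit Arguments. Unset Strict Implicit. Unset Printing Implicit Defensive.
Import Order.TTheory GRing.Theory Num.Theory.
Import numFieldNormedType.Exports.
Local Open Scope classical_set_scope.
Local Open Scope ring_scope.

(* The Borel sigma-algebra on a (metric) space X: the sigma-algebra
   generated by the open sets.  [borel X] is X itself (convertibly),
   equipped with this measurable structure.  MathComp-Analysis measurable
   types must be pointed (nonempty), hence [pointedMetricType]. *)
#[short(type="pointedMetricType")]
HB.structure Definition PointedMetric (K : numDomainType) :=
  { M of Pointed M & Metric K M }.

Definition borel {R : realType} (X : pointedMetricType R) :=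
  g_sigma_algebraType (@open X).

Section defs.
Context {R : realType} {X : pointedMetricType R}.

Definition birkhoff_avg (f : X -> X) (phi : X -> R) (n : nat) (x : X) : R :=
  n%:R^-1 * \sum_(j < n) phi (iter j f x).

Definition tau (f : X -> X) (x : X) (A : set X) : \bar R :=
  limn_esup (fun n => (birkhoff_avg f (\1_A) n x)%:E).

Definition diam_le (I : set X) (r : R) : Prop :=
  forall a b, I a -> I b -> mdist a b <= r.

(* nu_r(Y): infimum over countable covers of Y by open sets of diameter <= r
   (countable covers are indexed by nat; finite ones are padded by set0) *)
Definition nu_r (f : X -> X) (x : X) (r : R) (Y : set X) : \bar R :=
  ereal_inf [set (\sum_(k <oo) tau f x (I k))%E |
    I in [set I : nat -> set X |
           (forall k, open (I k) /\ diam_le (I k) r) /\ Y `<=` \bigcup_k I k]].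

Definition nu (f : X -> X) (x : X) (Y : set X) : \bar R :=
  ereal_sup [set nu_r f x r Y | r in [set r : R | 0 < r]].

(* eta_x = nu restricted to Borel sets; we only need eta_x(X) *)
Definition eta_x (f : X -> X) (x : X) (B : set X) : \bar R := nu f x B.

Definition f_invariant (f : X -> X) (nu0 : {measure set (borel X) -> \bar R}) : Prop :=
  forall A : set (borel X), measurable A -> nu0 (f @^-1` A) = nu0 A.

Definition mu_physical (f : X -> X) (mu nu0 : {measure set (borel X) -> \bar R}) : Prop :=
  f_invariant f nu0 /\
  exists U : set (borel X), measurable U /\ (0 < mu U)%E /\
    forall phi : X -> R, continuous phi ->
      forall x, U x ->
        (fun n => (birkhoff_avg f phi n x)%:E) @ \oo --> (\int[nu0]_y (phi y)%:E)%E.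

Definition gen_mu_physical (f : X -> X) (mu nu0 : {measure set (borel X) -> \bar R}) : Prop :=
  f_invariant f nu0 /\
  exists U : set (borel X), measurable U /\ (0 < mu U)%E /\
    forall phi : X -> R, continuous phi ->
      (forall x, U x -> cvgn (fun n => birkhoff_avg f phi n x)) /\
      (\int[mu]_(x in U) (limn (fun n => birkhoff_avg f phi n x))%:E
         = \int[nu0]_y (phi y)%:E)%E.

Definition ergodic (f : X -> X) (mu : {measure set (borel X) -> \bar R}) : Prop :=
  forall U : set (borel X), measurable U -> f @^-1` U = U ->
    mu U = 0%E \/ mu (~` U) = 0%E.

End defs.

(* Main.v *)
Require Import Defs.
From HB Require Import structures.
From mathcomp Require Import all_boot all_order all_algebra.
From mathcomp Require Import all_classical all_reals all_analysis.
From mathcomp Require Import measurable_realfun ring lra.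
Set Implicit Arguments. Unset Strict Implicit. Unset Printing Implicit Defensive.
Import Order.TTheory GRing.Theory Num.Theory.
Import numFieldNormedType.Exports.
Local Open Scope classical_set_scope.
Local Open Scope ring_scope.

(** Call [x] generic if the Birkhoff averages at [x] of every continuous
    function converge. The key fact is that [eta_x(X) = 1] exactly when [x] is
    generic. The inequality [eta_x(X) >= 1] always holds by compactness. A cover
    by small open sets with total upper frequency at most [1 + e] pins down, up
    to [O(e)], the frequency of visits to each piece of its disjointification,
    hence the averages of any continuous function. Conversely, if [x] is
    generic, then [X] is covered by small open sets whose overlaps have
    arbitrarily small frequency.

    By uniform approximation with countably many partitions of unity, the set
    [G] of generic points is Borel. If [mu G > 0], the Riesz representation of
    [phi |-> \int_G lim_n (average of phi at x) dmu(x)] is a generalized physical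
    measure; invariance comes from the invariance of the functional. If [mu] is
    ergodic, the sublevel sets of the limits of the countably many functions of
    the partitions are null or conull, so the limit functional is the same at
    almost every generic point, and its Riesz measure is physical. *)

(** * Continuous functions on compact metric spaces *)

Lemma continuous_mdistP (R : realType) (X : pointedMetricType R) (phi : X -> R) :
  continuous phi <-> forall x (e : R), 0 < e -> exists2 d : R, 0 < d &
    forall y, mdist x y < d -> `|phi x - phi y| < e.
Proof.
split=> [cphi x e e0|h x].
  have /cvgrPdist_lt/(_ _ e0)/nbhs_ballP[d /= d0 hd] := cphi x.
  by exists d => // y xy; apply: hd; rewrite ballEmdist.
apply/cvgrPdist_lt => e e0; have [d d0 hd] := h x _ e0.
by apply/nbhs_ballP; exists d => //= y; rewrite ballEmdist => /hd.
Qed.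

Lemma mdist_lipschitz (R : realType) (X : pointedMetricType R) (a x y : X) :
  `|mdist a x - mdist a y| <= mdist x y.
Proof.
have h1 := metric_triangle a x y; have h2 := metric_triangle a y x.
rewrite [mdist y x]metric_sym in h2.
by rewrite ler_norml; apply/andP; split; lra.
Qed.

Lemma mdist_continuous (R : realType) (X : pointedMetricType R) (a : X) :
  continuous (mdist a : X -> R).
Proof.
apply/continuous_mdistP => x e e0; exists e => // y xy.
exact: le_lt_trans (mdist_lipschitz _ _ _) xy.
Qed.

Lemma openP_mdist (R : realType) (X : pointedMetricType R) (O : set X) :
  open O <-> forall x, O x -> exists2 d : R, 0 < d & forall y, mdist x y < d -> O y.
Proof.
rewrite openE; split=> h x /h.
  move=> /nbhs_ballP[d /= d0 hd]; exists d => // y xy.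
  by apply: hd; rewrite ballEmdist.
by move=> [d d0 hd]; apply/nbhs_ballP; exists d => //= y; rewrite ballEmdist => /hd.
Qed.

Lemma compact_nat_subcover (T : ptopologicalType) (I : nat -> set T) :
  compact [set: T] -> (forall k, open (I k)) -> [set: T] `<=` \bigcup_k I k ->
  exists K, forall y, exists2 k, (k < K)%N & I k y.
Proof.
rewrite compact_cover => cT oI cov.
have [|D _ hD] := cT _ setT I (fun i _ => oI i); first exact: cov.
exists (\max_(i <- finmap.enum_fset D) i).+1 => y; have [k /= kD Iky] := hD y Logic.I.
by exists k => //; rewrite ltnS; apply: leq_bigmax_seq.
Qed.

Lemma compact_finite_net (R : realType) (X : pointedMetricType R) (r : R) :
  compact [set: X] -> 0 < r ->
  exists K, exists s : nat -> X, forall y, exists2 k, (k < K)%N & mdist (s k) y < r.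
Proof.
rewrite compact_cover => cX r0.
have [x _||D _ hD] := cX X setT (fun x => [set y | mdist x y < r]).
- apply/openP_mdist => y /= xy; exists (r - mdist x y); first by rewrite subr_gt0.
  by move=> z; rewrite ltrBrDl => /(le_lt_trans (metric_triangle _ _ _)).
- by move=> y _; exists y => //=; rewrite mdistxx.
exists (size (finmap.enum_fset D)), (nth point (finmap.enum_fset D)) => y.
have [x /= xD xy] := hD y Logic.I.
exists (index x (finmap.enum_fset D)); first by rewrite index_mem.
by rewrite nth_index.
Qed.

Lemma compact_continuous_bounded (R : realType) (X : pointedMetricType R) (phi : X -> R) :
  compact [set: X] -> continuous phi -> exists2 M, 0 < M & forall y, `|phi y| <= M.
Proof.
move=> cX cphi.
have /compact_bounded[M [_ hM]] : compact (phi @` setT).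
  by apply: continuous_compact => //; apply: continuous_subspaceT.
exists (Num.max (M + 1) 1); first by rewrite lt_max ltr01 orbT.
by move=> y; apply: hM; [rewrite lt_max ltrDl ltr01 | exists y].
Qed.

Lemma compact_uniform_continuity (R : realType) (X : pointedMetricType R) (phi :
  X -> R) (e : R) :
  compact [set: X] -> continuous phi -> 0 < e ->
  exists2 d : R, 0 < d & forall x y, mdist x y < d -> `|phi x - phi y| < e.
Proof.
move=> cX /continuous_mdistP cphi e0.
(* [I k] collects the points around which some radius larger than 1/(k+1) keeps the oscillation of
   [phi] below [e]. The strict inequality on [d] makes [I k] open, and a finite subcover bounds
   these radii from below. *)
pose I k := [set x : X | exists2 d, (k.+1%:R^-1 : R) < d &
  forall y z, mdist x y < d -> mdist x z < d -> `|phi y - phi z| < e].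
have [k|x _|K hK] := @compact_nat_subcover X I cX.
- apply/openP_mdist => x [d]; rewrite /I; set c := k.+1%:R^-1 => dk hd.
  (* Moving the centre by less than (d - c)/2 leaves the radius (d + c)/2, still above [c], since
     the two add up to [d]. *)
  exists ((d - c) / 2); first by rewrite divr_gt0// subr_gt0.
  move=> x' xx'; exists ((d + c) / 2); first by lra.
  move=> y z x'y x'z; have h1 := metric_triangle x x' y.
  have h2 := metric_triangle x x' z.
  by apply: hd; lra.
- have [d d0 hd] := cphi x (e / 2) ltac:(by rewrite divr_gt0).
  have [k hk] : exists k, k.+1%:R^-1 < d.
    by have [k _ /(_ k (leqnn k))] := near_infty_natSinv_lt (PosNum d0); exists k.
  exists k => //; exists d => // y z /hd xy /hd xz.
  rewrite (_ : phi y - phi z = - (phi x - phi y) + (phi x - phi z)); last by ring.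
  by rewrite (le_lt_trans (ler_normD _ _))// normrN; lra.
exists K.+1%:R^-1; first by rewrite invr_gt0 ltr0n.
move=> x y xy; have [k kK [d dk hd]] := hK x.
have Kk : (K.+1%:R^-1 : R) <= k.+1%:R^-1.
  by rewrite lef_pV2 ?posrE ?ltr0n// ler_nat ltnS ltnW.
apply: hd; last exact: lt_trans (lt_le_trans xy Kk) dk.
by rewrite mdistxx; apply: le_lt_trans dk; rewrite invr_ge0.
Qed.

(** * Continuous cut-off functions *)

Definition clamp {R : realType} (t : R) : R := Num.min 1 (Num.max 0 t).

Section clamp.
Context {R : realType}.
Implicit Types s t : R.

Lemma clamp_ge0 t : 0 <= clamp t.
Proof. by rewrite /clamp le_min ler01 le_max lexx. Qed.

Lemma clamp_le1 t : clamp t <= 1.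
Proof. by rewrite /clamp ge_min lexx. Qed.

Lemma clamp_eq1 t : 1 <= t -> clamp t = 1.
Proof. by move=> t1; rewrite /clamp max_r ?min_l//; lra. Qed.

Lemma clamp_eq0 t : t <= 0 -> clamp t = 0.
Proof. by move=> t0; rewrite /clamp max_l// min_r. Qed.

Lemma clamp_id t : 0 <= t <= 1 -> clamp t = t.
Proof. by case/andP=> t0 t1; rewrite /clamp max_r// min_r. Qed.

Lemma le_clamp s t : s <= t -> clamp s <= clamp t.
Proof.
move=> st; rewrite /clamp le_min ge_min lexx/= ge_min; apply/orP; right.
by rewrite ge_max le_max lexx/= le_max st orbT.
Qed.

Lemma clamp_lipschitz s t : `|clamp s - clamp t| <= `|s - t|.
Proof.
have h1 := ler_norm (s - t); have h2 := ler_norm (- (s - t)).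
rewrite normrN in h2; rewrite ler_norml /clamp /Num.min /Num.max.
by case: ifPn; case: ifPn; case: ifPn; case: ifPn => *; apply/andP; split; lra.
Qed.

End clamp.

Lemma continuous_clamp (R : realType) (X : topologicalType) (phi : X -> R) :
  continuous phi -> continuous (fun x => clamp (phi x)).
Proof.
move=> cphi x; apply/cvgrPdist_lt => e e0.
have /cvgrPdist_lt/(_ _ e0) := cphi x.
by apply: filterS => y; apply: le_lt_trans; exact: clamp_lipschitz.
Qed.

Lemma continuous_sum (R : realType) (X : topologicalType) (I : Type) (s : seq I)
    (P : pred I) (phi : I -> X -> R) : (forall i, continuous (phi i)) ->
  continuous (fun x => \sum_(i <- s | P i) phi i x).
Proof.
move=> cphi; elim: s => [|i s IHs].
  under eq_fun do rewrite big_nil; exact: cst_continuous.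
under eq_fun do rewrite big_cons.
by case: (P i) => // x; apply: cvgD; [exact: cphi|exact: IHs].
Qed.

Lemma continuous_prod (R : realType) (X : topologicalType) (I : Type) (s : seq I)
    (P : pred I) (phi : I -> X -> R) : (forall i, continuous (phi i)) ->
  continuous (fun x => \prod_(i <- s | P i) phi i x).
Proof.
move=> cphi; elim: s => [|i s IHs].
  under eq_fun do rewrite big_nil; exact: cst_continuous.
under eq_fun do rewrite big_cons.
by case: (P i) => // x; apply: cvgM; [exact: cphi|exact: IHs].
Qed.

(** The witness is the distance to the complement of [O], cut off at 1, which is 1-Lipschitz. If the
    complement is empty the infimum is over the empty set, so the constant 1 is taken instead. *)
Lemma open_positive_set (R : realType) (X : pointedMetricType R) (O : set X) :
  open O -> exists g : X -> R, [/\ continuous g, (forall y, 0 <= g y),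
    (forall y, O y -> 0 < g y) & (forall y, ~ O y -> g y = 0)].
Proof.
move=> oO; pose D y := [set Num.min 1 (mdist y a) | a in ~` O].
have [CO0|[a0 Oa0]] : O = setT \/ exists a, ~ O a.
  have [/existsNP ?|/contrapT h] := pselect (~ forall a, O a); first by right.
  by left; apply/seteqP; split=> // y _; exact: h.
  exists (fun=> 1); split=> [|y|y|y]; [exact: cst_continuous|exact: ler01|by []|].
  by rewrite CO0 => /(_ Logic.I).
have Dhas y : has_inf (D y).
  split; first by exists (Num.min 1 (mdist y a0)), a0.
  by exists 0 => _ [a _ <-]; rewrite le_min ler01 mdist_ge0.
have D0 y : 0 <= inf (D y).
  by apply: lb_le_inf => [|_ [a _ <-]];
    [exact: (Dhas y).1|rewrite le_min ler01 mdist_ge0].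
have Dlip x y : inf (D x) <= mdist x y + inf (D y).
  rewrite -lerBlDl; apply: lb_le_inf => [|_ [a Oa <-]]; first exact: (Dhas y).1.
  rewrite lerBlDl; apply: (@le_trans _ _ (Num.min 1 (mdist x a))).
    by apply: ge_inf; [exact: (Dhas x).2|exists a].
  have := metric_triangle x y a; have := mdist_ge0 x y.
  by rewrite /Num.min; case: ifPn; case: ifPn => *; lra.
exists (fun y => inf (D y)); split=> //.
- apply/continuous_mdistP => x e e0; exists e => // y xy.
  have := Dlip x y; have := Dlip y x; rewrite [mdist y x]metric_sym => *.
  by rewrite ltr_norml; apply/andP; split; lra.
- move=> y; have /openP_mdist := oO => /[apply] -[d d0 hd].
  apply: (@lt_le_trans _ _ (Num.min 1 d)); first by rewrite lt_min ltr01.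
  apply: lb_le_inf => [|_ [a Oa <-]]; first exact: (Dhas y).1.
  have : d <= mdist y a by rewrite leNgt; apply/negP => /hd.
  by rewrite /Num.min; case: ifPn; case: ifPn => *; lra.
- move=> y Oy; apply/eqP; rewrite eq_le D0 andbT.
  apply: ge_inf; first exact: (Dhas y).2.
  by exists y => //; rewrite mdistxx min_r.
Qed.

(** * Riesz representation *)

Lemma nneseries_le_partial (R : realType) (a : nat -> \bar R) (e : R) :
  (forall n, 0 <= a n)%E -> (\sum_(n <oo) a n < +oo)%E -> 0 < e ->
  exists N, (\sum_(n <oo) a n <= \sum_(0 <= n < N) a n + e%:E)%E.
Proof.
move=> a0 afin e0; apply/not_existsP => h.
set S := (\sum_(n <oo) a n)%E in afin h.
have Sfin : (S \is a fin_num)%E by rewrite ge0_fin_numE//; exact: nneseries_ge0.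
suff : (S <= S - e%:E)%E by rewrite leNgt lteBlDr// lteDl ?lte_fin ?e0.
rewrite {1}/S; apply: lime_le; first by apply: is_cvg_nneseries => n _ _; exact: a0.
apply: nearW => N; rewrite leeBrDr//; apply: ltW; rewrite ltNge.
exact/negP/h.
Qed.

(** The order of the quantifiers matters: one enumeration [g] of the pairs serves every double
    series, so a double family of functions and the values of a functional on it are re-indexed
    alike. *)
Lemma nneseries_nat2 : exists g : nat -> nat * nat,
  forall (R : realType) (a : nat -> nat -> \bar R), (forall i j, 0 <= a i j)%E ->
    (\sum_(k <oo) a (g k).1 (g k).2 = \sum_(i <oo) \sum_(j <oo) a i j)%E.
Proof.
have /card_esym/ppcard_eqP[g] := card_nat2; exists g => R a a0.
rewrite nneseries_esumT//.
rewrite -(reindex_esum setT setT g (fun ij => a ij.1 ij.2))//.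
rewrite [RHS]nneseries_esumT; last by move=> i; exact: nneseries_ge0.
under [RHS]eq_esum do rewrite nneseries_esumT//.
by rewrite esum_esum//; congr esum; apply/seteqP; split.
Qed.

Lemma nneseries_single (R : realType) (a : nat -> \bar R) :
  (0 <= a 0%N)%E -> (forall n, a n.+1 = 0%E) -> (\sum_(n <oo) a n = a 0%N)%E.
Proof.
move=> a00 a0; rewrite nneseries_recl//; last by case=> [|n] _; rewrite ?a0.
by rewrite eseries0 ?adde0//; case=> // n _ _.
Qed.

(** [Lam] is total on functions, but the laws are asked of continuous ones only: the intended
    functionals are limits of averages, which take default values where the limit does not exist. *)
Definition positive_functional {R : realType} {X : pointedMetricType R}
    (Lam : (X -> R) -> R) :=
  [/\ forall phi psi : X -> R, continuous phi -> continuous psi ->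
        Lam (fun y => phi y + psi y) = Lam phi + Lam psi,
      forall a (phi : X -> R), continuous phi -> Lam (fun y => a * phi y) = a * Lam phi
    & forall phi : X -> R, continuous phi -> (forall y, 0 <= phi y) -> 0 <= Lam phi].

(** * Positive functionals and the outer measure they induce *)

Section positive_functional_theory.
Context {R : realType} {X : pointedMetricType R} (Lam : (X -> R) -> R).
Hypothesis LamP : positive_functional Lam.
Implicit Types (phi psi : X -> R) (a : R) (A B O : set X).

Lemma pfunD phi psi : continuous phi -> continuous psi ->
  Lam (fun y => phi y + psi y) = Lam phi + Lam psi.
Proof. by case: LamP => h _ _; exact: h. Qed.

Lemma pfunZ a phi : continuous phi -> Lam (fun y => a * phi y) = a * Lam phi.
Proof. by case: LamP => _ h _; exact: h. Qed.

Lemma pfun_ge0 phi : continuous phi -> (forall y, 0 <= phi y) -> 0 <= Lam phi.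
Proof. by case: LamP => _ _ h; exact: h. Qed.

Lemma pfun0 : Lam (fun=> 0) = 0.
Proof.
have := @pfunZ 0 (fun=> 0) (@cst_continuous _ _ _).
by under eq_fun do rewrite mul0r; rewrite mul0r.
Qed.

Lemma pfunB phi psi : continuous phi -> continuous psi ->
  Lam (fun y => phi y - psi y) = Lam phi - Lam psi.
Proof.
move=> cphi cpsi; rewrite -[in RHS]mulN1r -(pfunZ _ cpsi) -pfunD//; last first.
  by move=> y; apply: cvgM; [exact: cvg_cst|exact: cpsi].
by congr Lam; apply/funext => y; rewrite mulN1r.
Qed.

Lemma pfun_le phi psi : continuous phi -> continuous psi ->
  (forall y, phi y <= psi y) -> Lam phi <= Lam psi.
Proof.
move=> cphi cpsi h; rewrite -subr_ge0 -pfunB//; apply: pfun_ge0 => [y|y].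
  by apply: cvgB; [exact: cpsi|exact: cphi].
by rewrite subr_ge0.
Qed.

Lemma pfun_cst a : Lam (fun=> a) = a * Lam (fun=> 1).
Proof.
by rewrite -pfunZ; [congr Lam; apply/funext => y; rewrite mulr1|exact: cst_continuous].
Qed.

Lemma pfun_sum (I : Type) (s : seq I) (phi : I -> X -> R) :
  (forall i, continuous (phi i)) ->
  Lam (fun y => \sum_(i <- s) phi i y) = \sum_(i <- s) Lam (phi i).
Proof.
move=> cphi; elim: s => [|i s IHs].
  by under eq_fun do rewrite big_nil; rewrite big_nil pfun0.
under eq_fun do rewrite big_cons.
by rewrite big_cons -IHs pfunD//; exact: continuous_sum.
Qed.

Definition continuous_cover (A : set X) (phi : nat -> X -> R) :=
  [/\ forall k, continuous (phi k), forall k y, 0 <= phi k y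
    & forall y, A y -> (1 <= \sum_(k <oo) (phi k y)%:E)%E].

(* The upper integral of Daniell, restricted to indicators. *)
Definition riesz_outer (A : set X) : \bar R :=
  ereal_inf [set (\sum_(k <oo) (Lam (phi k))%:E)%E | phi in continuous_cover A].

Local Open Scope ereal_scope.

Lemma riesz_outer_le A (phi : nat -> X -> R) : continuous_cover A phi ->
  riesz_outer A <= \sum_(k <oo) (Lam (phi k))%:E.
Proof. by move=> h; apply: ereal_inf_lbound; exists phi. Qed.

Lemma cover_pfun_ge0 A (phi : nat -> X -> R) k :
  continuous_cover A phi -> 0 <= (Lam (phi k))%:E.
Proof. by case=> c p _; rewrite lee_fin pfun_ge0. Qed.

Lemma riesz_outer_ge0 A : 0 <= riesz_outer A.
Proof.
apply: le_ereal_inf_tmp => _ [phi cov <-].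
by apply: nneseries_ge0 => k _ _; exact: cover_pfun_ge0 cov.
Qed.

Lemma riesz_outer_le1 A phi : continuous phi -> (forall y, 0 <= phi y)%R ->
  (forall y, A y -> 1 <= phi y)%R -> riesz_outer A <= (Lam phi)%:E.
Proof.
move=> cphi phi0 phi1; pose psi k : X -> R := if k is 0%N then phi else fun=> 0%R.
have psi0 k y : (0 <= psi k y)%R by case: k => //=.
rewrite (@le_trans _ _ (\sum_(k <oo) (Lam (psi k))%:E))//.
  apply: riesz_outer_le; split=> // [[|k]//=|y Ay]; first exact: cst_continuous.
  by rewrite nneseries_single ?lee_fin//; exact: phi1.
rewrite nneseries_single//=; first by rewrite lee_fin pfun_ge0.
by move=> n; rewrite pfun0.
Qed.

Lemma riesz_outer0 : riesz_outer set0 = 0.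
Proof.
apply/eqP; rewrite eq_le riesz_outer_ge0 andbT -[leRHS]/(0%R%:E) -pfun0.
by apply: riesz_outer_le1 => //; exact: cst_continuous.
Qed.

Lemma le_riesz_outer : {homo riesz_outer : A B / A `<=` B >-> A <= B}.
Proof.
move=> A B AB; apply: le_ereal_inf_tmp => _ [phi [c p cov] <-].
by apply: riesz_outer_le; split=> // y /AB; exact: cov.
Qed.

Lemma riesz_outer_le2 A (phi : nat -> nat -> X -> R) :
  (forall i j, continuous (phi i j)) -> (forall i j y, 0 <= phi i j y)%R ->
  (forall y, A y -> 1 <= \sum_(i <oo) \sum_(j <oo) (phi i j y)%:E) ->
  riesz_outer A <= \sum_(i <oo) \sum_(j <oo) (Lam (phi i j))%:E.
Proof.
move=> c p cov; have [g hg] := nneseries_nat2.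
rewrite -hg; last by move=> i j; rewrite lee_fin pfun_ge0.
apply: (@riesz_outer_le _ (fun k => phi (g k).1 (g k).2)); split=> // y Ay.
rewrite (hg R (fun i j => (phi i j y)%:E)); last by move=> i j; rewrite lee_fin.
exact: cov.
Qed.

(** Covers of the [A n] that are optimal up to e / 2^(n+1) form together a double family covering
    the union. An infinite value is set apart first, because near-optimal covers need a finite
    infimum. *)
Lemma riesz_outer_sigma_subadditive : sigma_subadditive riesz_outer.
Proof.
move=> A; have [[i ioo]|] := pselect (exists i, riesz_outer (A i) = +oo).
  rewrite (eseries_pinfty _ _ ioo) ?leey// => n _.
  by rewrite -ltNye (lt_le_trans _ (riesz_outer_ge0 _)).
rewrite -forallNE => Aoo; apply/lee_addgt0Pr => e e0.
rewrite (le_trans _ (epsilon_trick _ _ (ltW e0)))//; last first.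
  by move=> n; exact: riesz_outer_ge0.
have /choice[phi hphi] n : exists phi : nat -> X -> R, continuous_cover (A n) phi /\
    \sum_(k <oo) (Lam (phi k))%:E <= riesz_outer (A n) + (e / (2 ^ n.+1)%:R)%:E.
  have fin : riesz_outer (A n) \is a fin_num.
    by rewrite ge0_fin_numE ?riesz_outer_ge0// ltey; exact/eqP/Aoo.
  have en0 : (0 < e / (2 ^ n.+1)%:R)%R by rewrite divr_gt0// ltr0n expn_gt0.
  have [_ [phi cov <-] /ltW] := lb_ereal_inf_adherent en0 fin.
  by exists phi.
apply: (@le_trans _ _ (\sum_(i <oo) \sum_(j <oo) (Lam (phi i j))%:E)).
  apply: riesz_outer_le2 => [i|i|y [i _ Aiy]].
  - by have [[]] := hphi i.
  - by have [[]] := hphi i.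
  - have [[_ _ /(_ _ Aiy) h] _] := hphi i; apply: le_trans h _.
    have p' i' j : 0 <= (phi i' j y)%:E by have [[_ h _] _] := hphi i'; rewrite lee_fin.
    rewrite (@nneseriesD1 _ (fun i => \sum_(j <oo) (phi i j y)%:E) i xpredT)//;
      last by move=> k _; exact: nneseries_ge0.
    by rewrite leeDl//; apply: nneseries_ge0 => k _ _; exact: nneseries_ge0.
apply: lee_nneseries => [i _ _|i _]; last exact: (hphi i).2.
by apply: nneseries_ge0 => k _ _; exact: cover_pfun_ge0 (hphi i).1.
Qed.

Definition riesz_outer_measure : {outer_measure set X -> \bar R} :=
  HB.pack riesz_outer (isOuterMeasure.Build R X riesz_outer
    riesz_outer0 riesz_outer_ge0 le_riesz_outer riesz_outer_sigma_subadditive).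

End positive_functional_theory.

(** * The Riesz measure: Borel sets, invariance, integrals *)

Section riesz_measure.
Context {R : realType} {X : pointedMetricType R} (Lam : (X -> R) -> R).
Hypothesis LamP : positive_functional Lam.
Implicit Types (phi psi : X -> R) (A B O : set X).
Local Notation m := (riesz_outer Lam).
Local Open Scope ereal_scope.

Lemma partial_sum_clamp (g : X -> R) phi N : continuous g -> continuous phi ->
  \sum_(0 <= n < N)
    (Lam (fun y => phi y * (clamp (n.+1%:R * g y) - clamp (n%:R * g y)))%R)%:E =
  (Lam (fun y => phi y * clamp (N%:R * g y))%R)%:E.
Proof.
move=> cg cphi.
have cu n : continuous (fun y => clamp (n%:R * g y)%R).
  by apply: continuous_clamp => y; apply: cvgM; [exact: cvg_cst|exact: cg].
have cphiu n : continuous (fun y => phi y * clamp (n%:R * g y))%R.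
  by move=> y; apply: cvgM; [exact: cphi|exact: cu].
elim: N => [|N IHN].
  rewrite big_nil; congr EFin; rewrite -(pfun0 LamP); congr Lam; apply/funext => y.
  by rewrite mul0r clamp_eq0 ?mulr0.
rewrite big_nat_recr//= IHN -EFinD; congr EFin.
rewrite (_ : (fun y => _ * (_ - _))%R =
  (fun y => phi y * clamp (N.+1%:R * g y) - phi y * clamp (N%:R * g y))%R).
  by rewrite pfunB// addrC subrK.
by apply/funext => y; rewrite mulrBr.
Qed.

(** The functions [u n], the cut-offs of n * g, increase to the indicator of [O] and vanish outside
    [O]. A cover [phi] of [A] thus splits in two: the increments [v k n] of phi k * u n cover the
    part in [O], and the remainders [w k], equal to phi k * (1 - u (N k)), cover the part outside.
    With [N k] so large that the increments beyond it cost at most e / 2^(k+1), the two costs add up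
    to that of [phi] plus [e]. *)
Lemma open_caratheodory O : open O -> (riesz_outer_measure LamP).-caratheodory O.
Proof.
move=> oO; have [g [cg g0 gO gNO]] := open_positive_set oO.
apply: le_caratheodory_measurable => A /=.
apply: le_ereal_inf_tmp => _ [phi cov <-]; case: (cov) => cphi phi0 cA.
have [->|Cfin] := eqVneq (\sum_(k <oo) (Lam (phi k))%:E) +oo; first by rewrite leey.
apply/lee_addgt0Pr => e e0.
pose u n y : R := clamp (n%:R * g y).
have cu n : continuous (u n).
  by apply: continuous_clamp => y; apply: cvgM; [exact: cvg_cst|exact: cg].
have u_le n y : (u n y <= u n.+1 y)%R.
  by apply: le_clamp; rewrite ler_wpM2r// ler_nat.
pose v k n y := (phi k y * (u n.+1 y - u n y))%R.
have cv k n : continuous (v k n).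
  by move=> y; apply: cvgM; [exact: cphi|apply: cvgB; exact: cu].
have v0 k n y : (0 <= v k n y)%R by rewrite mulr_ge0// subr_ge0.
have Lv0 k n : 0 <= (Lam (v k n))%:E by rewrite lee_fin (pfun_ge0 LamP).
have part k N :
  \sum_(0 <= n < N) (Lam (v k n))%:E = (Lam (fun y => phi k y * u N y)%R)%:E.
  exact: partial_sum_clamp.
have cphiu k N : continuous (fun y => phi k y * u N y)%R.
  by move=> y; apply: cvgM; [exact: cphi|exact: cu].
have vfin k : \sum_(n <oo) (Lam (v k n))%:E < +oo.
  apply: (@le_lt_trans _ _ (Lam (phi k))%:E); last exact: ltry.
  apply: lime_le; first by apply: is_cvg_nneseries => n _ _.
  apply: nearW => N; rewrite part lee_fin (pfun_le LamP)// => y.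
  by rewrite ler_piMr// clamp_le1.
have /choice[N hN] k : exists N,
    \sum_(n <oo) (Lam (v k n))%:E <=
      (Lam (fun y => phi k y * u N y)%R)%:E + (e / (2 ^ k.+1)%:R)%:E.
  have [|N] := @nneseries_le_partial _ _ (e / (2 ^ k.+1)%:R) (Lv0 k) (vfin k).
    by rewrite divr_gt0// ltr0n expn_gt0.
  by rewrite part; exists N.
pose w k y := (phi k y * (1 - u (N k) y))%R.
have cw k : continuous (w k).
  by move=> y; apply: cvgM; [exact: cphi|apply: cvgB; [exact: cvg_cst|exact: cu]].
have w0 k y : (0 <= w k y)%R by rewrite mulr_ge0// subr_ge0 clamp_le1.
have Lw k : Lam (w k) = (Lam (phi k) - Lam (fun y => phi k y * u (N k) y))%R.
  rewrite -(pfunB LamP)//; congr Lam; apply/funext => y.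
  by rewrite /w mulrBr mulr1.
have h1 : m (A `&` O) <= \sum_(k <oo) \sum_(n <oo) (Lam (v k n))%:E.
  apply: (riesz_outer_le2 LamP) => // y [Ay Oy].
  rewrite (le_trans (cA _ Ay))//; apply: lee_nneseries => [k _ _|k _].
    by rewrite lee_fin.
  (* Once M * g y >= 1, the telescoping partial sum up to [M] is already the whole of [phi k y]. *)
  pose M := Num.bound (g y)^-1.
  have hM : (1 <= M%:R * g y)%R.
    by rewrite -ler_pdivrMr ?gO// mul1r ltW// archi_boundP// invr_ge0.
  rewrite (le_trans _ (@nneseries_lim_ge _ _ _ 0%N M _))//; last first.
    by move=> n _ _; rewrite lee_fin.
  rewrite sumEFin lee_fin /v -big_distrr/= telescope_sumr//.
  by rewrite /u clamp_eq1// mul0r clamp_eq0// subr0 mulr1.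
have h2 : m (A `&` ~` O) <= \sum_(k <oo) (Lam (w k))%:E.
  apply: riesz_outer_le; split=> // y [Ay Oy]; rewrite (le_trans (cA _ Ay))//.
  apply: lee_nneseries => [k _ _|k _]; rewrite lee_fin//.
  by rewrite /w /u gNO// mulr0 clamp_eq0// subr0 mulr1.
rewrite (le_trans (leeD h1 h2))// -nneseriesD; last 2 first.
- by move=> k _ _; apply: nneseries_ge0 => n _ _; exact: Lv0.
- by move=> k _ _; rewrite lee_fin (pfun_ge0 LamP).
rewrite (le_trans _ (epsilon_trick _ _ (ltW e0)))//; last first.
  by move=> k; rewrite lee_fin (pfun_ge0 LamP).
apply: lee_nneseries => [k _ _|k _].
  rewrite adde_ge0//; first by apply: nneseries_ge0 => n _ _; exact: Lv0.
  by rewrite lee_fin (pfun_ge0 LamP).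
rewrite (le_trans (leeD2r _ (hN k)))// Lw -!EFinD lee_fin.
by set q := (e / _)%R; set p := Lam (fun y => _); lra.
Qed.

(** For the lower bound, a Dini argument: the open sets where a partial sum of the cover exceeds 1 -
    d grow to [X], so by compactness one partial sum exceeds 1 - d everywhere, and finite additivity
    and monotonicity of [Lam] conclude. *)
Lemma riesz_outerT : compact [set: X] -> m setT = (Lam (fun=> 1%R))%:E.
Proof.
move=> cX; apply/eqP; rewrite eq_le; apply/andP; split.
  by apply: (riesz_outer_le1 LamP) => //; exact: cst_continuous.
apply: le_ereal_inf_tmp => _ [phi cov <-]; case: (cov) => cphi phi0 cT.
have L0 : (0 <= Lam (fun=> 1))%R by apply: (pfun_ge0 LamP) => //; exact: cst_continuous.
apply/lee_addgt0Pr => e e0.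
(* Chosen so that d * Lam 1 <= e; the added 1 keeps the denominator positive. *)
pose d := (e / (Lam (fun=> 1) + 1))%R.
have d0 : (0 < d)%R by rewrite divr_gt0// ltr_wpDl.
pose I K := [set y : X | 1 - d < \sum_(0 <= k < K) phi k y]%R.
have [K|y _|K hK] := @compact_nat_subcover X I cX.
- have cs : continuous (fun y => \sum_(0 <= k < K) phi k y)%R by exact: continuous_sum.
  rewrite (_ :
    I K = (fun y => \sum_(0 <= k < K) phi k y)%R @^-1` [set t | 1 - d < t]%R) //.
  by apply: open_comp => //; exact: open_gt.
- apply: contrapT => h.
  suff : 1 <= (1 - d)%:E by rewrite lee_fin; lra.
  rewrite (le_trans (cT y Logic.I))//.
  apply: lime_le; first by apply: is_cvg_nneseries => n _ _; rewrite lee_fin.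
  apply: nearW => K; rewrite sumEFin lee_fin leNgt; apply/negP => hK.
  by apply: h; exists K.
have le y : (1 - d <= \sum_(0 <= k < K) phi k y)%R.
  have [k kK /ltW/le_trans] := hK y; apply.
  rewrite [leRHS](@big_cat_nat _ _ _ k)//=; last exact: ltnW.
  by rewrite lerDl sumr_ge0.
have : ((1 - d) * Lam (fun=> 1) <= \sum_(0 <= k < K) Lam (phi k))%R.
  rewrite -(pfun_cst LamP) -(pfun_sum LamP)//; apply: (pfun_le LamP) => //.
    exact: cst_continuous.
  exact: continuous_sum.
move=> h; apply: (@le_trans _ _ (\sum_(0 <= k < K) (Lam (phi k))%:E + e%:E)).
  rewrite sumEFin -EFinD lee_fin.
  have : (d * Lam (fun=> 1) <= e)%R.
    by rewrite /d mulrAC ler_pdivrMr ?ltr_wpDl// mulrDr mulr1 lerDl ltW.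
  by move: h; set s := (\sum_(0 <= k < K) _)%R; rewrite mulrBl mul1r => *; lra.
rewrite leeD2r//; apply: nneseries_lim_ge => n _ _.
by rewrite lee_fin (pfun_ge0 LamP).
Qed.

Lemma borel_caratheodory (A : set (borel X)) : measurable A ->
  (riesz_outer_measure LamP).-caratheodory A.
Proof.
move: A; apply: smallest_sub; last by move=> A; exact: open_caratheodory.
split=> [|A mA|F mF].
- exact: caratheodory_measurable_set0.
- by rewrite setTD; exact: caratheodory_measurable_setC.
- exact: caratheodory_measurable_bigcup.
Qed.

Let riesz_fun : set (borel X) -> \bar R := riesz_outer Lam.

Let riesz_fun_sigma_additive : semi_sigma_additive riesz_fun.
Proof.
move=> F mF tF mUF.
apply: (@caratheodory_measure_sigma_additive R X (riesz_outer_measure LamP)) => //.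
  by move=> i; exact: borel_caratheodory.
exact: borel_caratheodory.
Qed.

Definition riesz_measure : {measure set (borel X) -> \bar R} :=
  HB.pack riesz_fun (isMeasure.Build _ (borel X) R riesz_fun
    (riesz_outer0 LamP) (riesz_outer_ge0 LamP) riesz_fun_sigma_additive).

(** Composing a cover of [A] with [f] gives a cover of the preimage at the same cost, so taking
    preimages does not increase the measure. The same inequality for the complement, with the total
    mass finite, forces equality. *)
Lemma riesz_measure_invariant (f : X -> X) :
  compact [set: X] -> continuous f ->
  (forall phi, continuous phi -> Lam (phi \o f) = Lam phi) ->
  f_invariant f riesz_measure.
Proof.
move=> cX cf Lf.
have mpre A : m (f @^-1` A) <= m A.
  apply: le_ereal_inf_tmp => _ [phi [cphi phi0 cov] <-].
  rewrite [leRHS](_ : _ = \sum_(k <oo) (Lam (phi k \o f))%:E).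
    apply: riesz_outer_le; split=> [k|k y|y]; last exact: cov.
      by move=> y; apply: continuous_comp; [exact: cf|exact: cphi].
    exact: phi0.
  by apply: eq_eseriesr => k _; rewrite Lf.
have mf (A : set (borel X)) : measurable A -> measurable (f @^-1` A : set (borel X)).
  move=> mA; have : measurable_fun (setT : set (borel X)) (f : borel X -> borel X).
    apply: (@measurability _ _ (borel X) (borel X) _ _ (@open X)) => //.
    move=> _ [U oU <-]; rewrite setTI; apply: sub_sigma_algebra.
    by apply: open_comp oU => y _; exact: cf.
  by move=> /(_ measurableT _ mA); rewrite setTI.
move=> A mA; apply/eqP; rewrite eq_le mpre//=.
have mCA : measurable (~` A : set (borel X)) by exact: measurableC.
have Tfin : m setT < +oo by rewrite riesz_outerT// ltry.
have dec (B : set (borel X)) : measurable B -> m B + m (~` B) = m setT.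
  move=> mB; rewrite -(setUv B).
  by rewrite -(measureU riesz_measure)//; [exact: measurableC|exact: setICr].
have fin (B : set X) : m B \is a fin_num.
  rewrite ge0_fin_numE ?(riesz_outer_ge0 LamP)//.
  by apply: le_lt_trans Tfin; exact: le_riesz_outer.
have := dec _ (mf _ mA); rewrite -(dec _ mA) preimage_setC => h.
rewrite -(leeD2rE _ _ (fin (~` A))) -h leeD2l//; exact: mpre.
Qed.

Lemma continuous_measurable_borel phi :
  continuous phi -> measurable_fun (setT : set (borel X)) (phi : borel X -> R).
Proof.
move=> cphi; apply: (measurability _ (RGenOInfty.measurableE R)).
move=> _ [_ [a ->] <-]; rewrite setTI; apply: sub_sigma_algebra.
by apply: open_comp => [y _|]; [exact: cphi|exact: interval_open].
Qed.

(** Layer decomposition: the [i]-th term is the length of the part of [0, t] lying between i and i +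
    1. *)
Lemma sum_clamp_sub (t : R) N : (0 <= t)%R -> (t <= N%:R)%R ->
  (\sum_(0 <= i < N) clamp (t - i%:R) = t)%R.
Proof.
have h M s : (0 <= s)%R -> (\sum_(0 <= i < M) clamp (s - i%:R) = Num.min s M%:R)%R.
  move=> s0; elim: M => [|M IHM]; first by rewrite big_nil min_r.
  rewrite big_nat_recr//= IHM -natr1; have [sM|sM] := leP s M%:R.
    by rewrite clamp_eq0 ?subr_le0// addr0 min_l// (le_trans sM)// lerDl.
  have [sM1|sM1] := leP s (M%:R + 1)%R; last by rewrite clamp_eq1//; lra.
  by rewrite clamp_id; [lra|apply/andP; split; lra].
by move=> t0 tN; rewrite h// min_l.
Qed.

(** Cut [phi] into [N] layers of height [d]: it is the sum of the d * L i, and [L i] equals 1 on the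
    superlevel set [A i], whose measure is therefore at most [Lam (L i)]. Since [phi] is at most [d]
    plus [d] times the sum of the indicators of the [A i], integrating costs an extra [d] times the
    total mass. *)
Lemma riesz_integral_le phi : compact [set: X] -> continuous phi ->
  (forall y, 0 <= phi y)%R ->
  \int[riesz_measure]_y (phi y)%:E <= (Lam phi)%:E.
Proof.
move=> cX cphi phi0; have [M M0 hM] := compact_continuous_bounded cX cphi.
have mphi := continuous_measurable_borel cphi.
have mT : riesz_measure setT = (Lam (fun=> 1%R))%:E by exact: riesz_outerT.
have L0 : (0 <= Lam (fun=> 1))%R by apply: (pfun_ge0 LamP) => //; exact: cst_continuous.
apply/lee_addgt0Pr => e e0.
pose d := (e / (Lam (fun=> 1) + 1))%R.
have d0 : (0 < d)%R by rewrite divr_gt0// ltr_wpDl.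
have dL : (d * Lam (fun=> 1) <= e)%R.
  by rewrite /d mulrAC ler_pdivrMr ?ltr_wpDl// mulrDr mulr1 lerDl ltW.
pose N := Num.bound (M / d).
have phiN y : (phi y / d <= N%:R)%R.
  rewrite (le_trans _ (ltW (archi_boundP _)))//; last by rewrite divr_ge0 ?ltW.
  by rewrite ler_pM2r ?invr_gt0// (le_trans (ler_norm _)).
pose A i : set (borel X) := [set y | i.+1%:R * d <= phi y]%R.
have mA i : measurable (A i).
  rewrite -[A i]setTI.
  rewrite (_ : A i = (phi : borel X -> R) @^-1` `[(i.+1%:R * d)%R, +oo[%classic);
    first exact: mphi.
  by apply/seteqP; split=> y /=; rewrite in_itv/= andbT.
pose L i y := clamp (phi y / d - i%:R).
have cL i : continuous (L i).
  apply: continuous_clamp => y; apply: cvgB; last exact: cvg_cst.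
  by apply: cvgM; [exact: cphi|exact: cvg_cst].
have AL i : riesz_measure (A i) <= (Lam (L i))%:E.
  apply: (riesz_outer_le1 LamP) => // [y|y]; first exact: clamp_ge0.
  rewrite /A /= => h; rewrite /L clamp_eq1// lerBrDr nat1r.
  by rewrite ler_pdivlMr.
pose h y := (d + \sum_(0 <= i < N) d * \1_(A i) y)%R.
have phih y : (phi y <= h y)%R.
  have [pd|dp] := leP (phi y) d.
    by rewrite (le_trans pd)// lerDl sumr_ge0// => i _; rewrite mulr_ge0// ltW.
  rewrite -lerBlDl -mulr_sumr -ler_pdivrMl//.
  (* Decompose (phi y - d) / d rather than phi y / d: its [i]-th layer vanishes outside [A i]. *)
  have p0 : (0 <= d^-1 * (phi y - d))%R.
    by rewrite mulr_ge0 ?invr_ge0 ?subr_ge0// ltW.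
  have p1 : (d^-1 * (phi y - d) <= N%:R)%R.
    rewrite (le_trans _ (phiN y))// mulrC ler_pM2r ?invr_gt0//.
    by rewrite lerBlDr lerDl ltW.
  rewrite -[leLHS](sum_clamp_sub p0 p1).
  apply: ler_sum => i _; rewrite indicE; have [_|] := boolP (y \in A i).
    exact: clamp_le1.
  rewrite notin_setE /A /= => /negP; rewrite -ltNge => hi.
  rewrite clamp_eq0// subr_le0 ler_pdivrMl// lerBlDr.
  by rewrite (le_trans (ltW hi))// -natr1 mulrDl mul1r mulrC.
have mh : measurable_fun (setT : set (borel X)) (fun y => (h y)%:E).
  apply/measurable_EFinP; apply: measurable_funD => //.
  apply: measurable_sum => i; apply: measurable_funM => //.
apply: (@le_trans _ _ (\int[riesz_measure]_y (h y)%:E)).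
  apply: ge0_le_integral => //.
  - by move=> y _; rewrite lee_fin.
  - exact/measurable_EFinP.
  - by move=> y _; rewrite lee_fin.
under eq_integral do rewrite EFinD -sumEFin.
rewrite ge0_integralD//; last 3 first.
- by move=> y _; rewrite lee_fin ltW.
- by move=> y _; rewrite sume_ge0// => i _; rewrite lee_fin mulr_ge0// ltW.
- apply: emeasurable_sum => i; apply/measurable_EFinP; exact: measurable_funM.
rewrite integral_cst// ge0_integral_sum//; last 2 first.
- move=> i; apply/measurable_EFinP; exact: measurable_funM.
- by move=> i y _; rewrite lee_fin mulr_ge0// ltW.
rewrite mT addeC; apply: leeD; last by rewrite -EFinM lee_fin.
apply: (@le_trans _ _ (\sum_(0 <= i < N) (d * Lam (L i))%:E)).
  apply: lee_sum => i _; under eq_integral do rewrite EFinM.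
  rewrite ge0_integralZl_EFin//; last 2 first.
  - exact/measurable_EFinP.
  - exact: ltW.
  rewrite integral_indic// setIT [leRHS]EFinM; apply: lee_wpmul2l; last exact: AL.
  by rewrite lee_fin ltW.
rewrite sumEFin lee_fin -mulr_sumr -(pfun_sum LamP); last exact: cL.
rewrite -(pfunZ LamP); last first.
  exact: continuous_sum.
rewrite (_ : (fun y => _) = phi)//; apply/funext => y.
rewrite sum_clamp_sub; last exact: phiN; last by rewrite divr_ge0// ltW.
by rewrite mulrC divfK// gt_eqF.
Qed.

(** The inequality for nonnegative functions applies to M + phi and M - phi; the constants cancel
    because the total mass is [Lam] of 1, which leaves both inequalities for [phi]. *)
Lemma riesz_integral phi : compact [set: X] -> continuous phi ->
  \int[riesz_measure]_y (phi y)%:E = (Lam phi)%:E.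
Proof.
move=> cX cphi; have [M M0 hM] := compact_continuous_bounded cX cphi.
have mphi := continuous_measurable_borel cphi.
have mT : riesz_measure setT = (Lam (fun=> 1%R))%:E by exact: riesz_outerT.
have bounded_int psi : continuous psi -> riesz_measure.-integrable setT (EFin \o psi).
  move=> cpsi; have [B B0 hB] := compact_continuous_bounded cX cpsi.
  apply: measurable_bounded_integrable => //; first by rewrite mT ltry.
    exact: continuous_measurable_borel.
  by exists B; split=> [|b Bb y _]; [exact: num_real|]; exact: le_trans (hB y) (ltW Bb).
have cM : continuous ((fun=> M) : X -> R) by exact: cst_continuous.
have cN : continuous (fun y => -1 * phi y)%R.
  by move=> y; apply: cvgM; [exact: cvg_cst|exact: cphi].
have key psi : continuous psi -> (forall y, `|psi y| <= M)%R ->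
    \int[riesz_measure]_y (psi y)%:E <= (Lam psi)%:E.
  move=> cpsi bpsi.
  have := @riesz_integral_le (fun y => M + psi y)%R cX.
  have -> : \int[riesz_measure]_y (M + psi y)%:E =
      (M * Lam (fun=> 1%R))%:E + \int[riesz_measure]_y (psi y)%:E.
    rewrite (@integralD_EFin _ (borel X) R riesz_measure setT measurableT
      (fun=> M) psi)//.
    - by rewrite integral_cst// mT.
    - exact: bounded_int.
    - exact: bounded_int.
  rewrite (pfunD LamP)// (pfun_cst LamP M) EFinD leeD2lE//; apply.
    by move=> y; apply: cvgD; [exact: cvg_cst|exact: cpsi].
  by move=> y; have := bpsi y; rewrite ler_norml => /andP[? _]; lra.
apply/eqP; rewrite eq_le key//=.
have := key _ cN; rewrite (pfunZ LamP)//.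
under eq_integral do rewrite EFinM.
rewrite integralZl//; last exact: bounded_int.
rewrite EFinM !mulN1e leeN2; apply=> y.
by rewrite normrM normrN1 mul1r.
Qed.
End riesz_measure.

(** * Birkhoff averages and upper frequencies *)

Section birkhoff.
Context {R : realType} {X : pointedMetricType R} (f : X -> X).
Implicit Types (phi psi : X -> R) (A : set X) (x : X) (n : nat).

Lemma birkhoff_avgD phi psi n x : birkhoff_avg f (fun y => phi y + psi y) n x =
  birkhoff_avg f phi n x + birkhoff_avg f psi n x.
Proof. by rewrite /birkhoff_avg big_split mulrDr. Qed.

Lemma birkhoff_avgZ a phi n x :
  birkhoff_avg f (fun y => a * phi y) n x = a * birkhoff_avg f phi n x.
Proof. by rewrite /birkhoff_avg -mulr_sumr mulrCA. Qed.

Lemma birkhoff_avgB phi psi n x : birkhoff_avg f (fun y => phi y - psi y) n x =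
  birkhoff_avg f phi n x - birkhoff_avg f psi n x.
Proof. by rewrite /birkhoff_avg sumrB mulrBr. Qed.

Lemma birkhoff_avg_sum (I : Type) (s : seq I) (phi : I -> X -> R) n x :
  birkhoff_avg f (fun y => \sum_(i <- s) phi i y) n x =
  \sum_(i <- s) birkhoff_avg f (phi i) n x.
Proof. by rewrite /birkhoff_avg exchange_big mulr_sumr. Qed.

Lemma birkhoff_avg_cst a n x : (0 < n)%N -> birkhoff_avg f (fun=> a) n x = a.
Proof.
move=> n0; rewrite /birkhoff_avg sumr_const card_ord -[a *+ n]mulr_natr mulrCA.
by rewrite mulVf ?mulr1// pnatr_eq0 -lt0n.
Qed.

Lemma le_birkhoff_avg phi psi n x : (forall y, phi y <= psi y) ->
  birkhoff_avg f phi n x <= birkhoff_avg f psi n x.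
Proof. by move=> h; rewrite ler_wpM2l ?invr_ge0// ler_sum. Qed.

Lemma birkhoff_avg_ge0 phi n x : (forall y, 0 <= phi y) -> 0 <= birkhoff_avg f phi n x.
Proof. by move=> h; rewrite mulr_ge0 ?invr_ge0// sumr_ge0. Qed.

Lemma birkhoff_avg_dist phi psi e n x : 0 <= e -> (forall y, `|phi y - psi y| <= e) ->
  `|birkhoff_avg f phi n x - birkhoff_avg f psi n x| <= e.
Proof.
(* The average over no terms is 0, by the convention that 0 has inverse 0. *)
move=> e0 h; case: n => [|n]; first by rewrite /birkhoff_avg invr0 !mul0r subrr normr0.
rewrite -birkhoff_avgB ler_norml -(@birkhoff_avg_cst (- e) n.+1 x)//.
rewrite -[X in _ <= _ <= X](@birkhoff_avg_cst e n.+1 x)//.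
by apply/andP; split; apply: le_birkhoff_avg => y; have := h y;
  rewrite ler_norml => /andP[].
Qed.

Lemma birkhoff_avg_comp phi n x :
  birkhoff_avg f phi n (f x) = birkhoff_avg f (phi \o f) n x.
Proof. by congr (_ * _); apply: eq_bigr => j _; rewrite -iterSr. Qed.

Lemma continuous_birkhoff_avg phi n : continuous f -> continuous phi ->
  continuous (birkhoff_avg f phi n).
Proof.
move=> cf cphi; have ci j : continuous (iter j f).
  elim: j => [|j IHj] y; first exact: cvg_id.
  by apply: (@continuous_comp _ _ _ (iter j f) f); [exact: IHj|exact: cf].
move=> y; apply: cvgM; first exact: cvg_cst.
apply: (@continuous_sum R X _ _ _ (fun j : 'I_n => phi \o iter j f)) => j z.
by apply: continuous_comp; [exact: ci|exact: cphi].
Qed.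

Lemma birkhoff_avg_shift phi M n x : (forall y, `|phi y| <= M) ->
  `|birkhoff_avg f phi n (f x) - birkhoff_avg f phi n x| <= 2 * M * n%:R^-1.
Proof.
move=> hM; rewrite /birkhoff_avg -mulrBr normrM ger0_norm ?invr_ge0//.
rewrite [leRHS]mulrC ler_wpM2l ?invr_ge0//.
have -> : \sum_(j < n) phi (iter j f (f x)) - \sum_(j < n) phi (iter j f x) =
    phi (iter n f x) - phi x.
  elim: n => [|n IHn]; first by rewrite !big_ord0 !subrr.
  by rewrite !big_ord_recr/= opprD addrACA IHn -iterSr /=; ring.
by rewrite (le_trans (ler_normB _ _))// mulr_natl mulr2n lerD.
Qed.

Definition generic x := forall phi, continuous phi ->
  cvgn (fun n => birkhoff_avg f phi n x).

Definition birkhoff_lim x phi : R := limn (fun n => birkhoff_avg f phi n x).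

Lemma birkhoff_shift_cvg0 phi x : compact [set: X] -> continuous phi ->
  (fun n => birkhoff_avg f phi n (f x) - birkhoff_avg f phi n x) @ \oo --> (0 : R).
Proof.
move=> cX cphi; have [M M0 hM] := compact_continuous_bounded cX cphi.
apply/cvgr0Pnorm_lt => e e0.
have : (fun n => 2 * M * n%:R^-1) @ \oo --> (0 : R).
  rewrite -[0](mulr0 (2 * M)); apply: cvgM; first exact: cvg_cst.
  have := @cvg_harmonic R; rewrite /harmonic => h.
  by rewrite -cvg_shiftS.
move=> /cvgr0Pnorm_lt/(_ _ e0); apply: filterS => n hn.
by apply: (le_lt_trans (birkhoff_avg_shift _ _ hM)); apply: le_lt_trans hn;
  exact: ler_norm.
Qed.

Lemma cvgn_birkhoff_shift phi x : compact [set: X] -> continuous phi ->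
  cvgn (fun n => birkhoff_avg f phi n (f x)) <-> cvgn (fun n => birkhoff_avg f phi n x).
Proof.
move=> cX cphi; have h := birkhoff_shift_cvg0 x cX cphi; split=> c.
  rewrite (_ : (fun n => _) = (fun n => birkhoff_avg f phi n (f x)) -
      (fun n => birkhoff_avg f phi n (f x) - birkhoff_avg f phi n x)).
    by apply: is_cvgB => //; apply/cvg_ex; exists 0.
  by apply/funext => n /=; rewrite !fctE opprB addrC subrK.
rewrite (_ :
  (fun n => _) = (fun n => birkhoff_avg f phi n (f x) - birkhoff_avg f phi n x) +
   (fun n => birkhoff_avg f phi n x)).
  by apply: is_cvgD => //; apply/cvg_ex; exists 0.
by apply/funext => n /=; rewrite !fctE subrK.
Qed.

Lemma birkhoff_lim_shift phi x : compact [set: X] -> continuous phi ->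
  cvgn (fun n => birkhoff_avg f phi n x) -> birkhoff_lim (f x) phi = birkhoff_lim x phi.
Proof.
move=> cX cphi c; have /cvg_lim h := birkhoff_shift_cvg0 x cX cphi.
have c' : cvgn (fun n => birkhoff_avg f phi n (f x)) by apply/cvgn_birkhoff_shift.
apply/eqP; rewrite -subr_eq0 /birkhoff_lim -limB//; apply/eqP/h; exact: Rhausdorff.
Qed.

Lemma generic_shift x : compact [set: X] -> generic (f x) <-> generic x.
Proof.
by move=> cX; split=> gx phi cphi; apply/(cvgn_birkhoff_shift x cX cphi); exact: gx.
Qed.

Lemma birkhoff_limP x : generic x -> positive_functional (birkhoff_lim x).
Proof.
move=> gx; split=> [phi psi cphi cpsi|a phi cphi|phi cphi phi0].
- apply: cvg_lim; first exact: Rhausdorff.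
  under eq_fun do rewrite birkhoff_avgD.
  by apply: cvgD; exact: gx.
- apply: cvg_lim; first exact: Rhausdorff.
  under eq_fun do rewrite birkhoff_avgZ.
  by apply: cvgM; [exact: cvg_cst|exact: gx].
- apply: limr_ge; first exact: gx.
  by apply: nearW => n; exact: birkhoff_avg_ge0.
Qed.

Lemma birkhoff_lim1 x : birkhoff_lim x (fun=> 1) = 1.
Proof.
apply: cvg_lim; first exact: Rhausdorff.
apply: cvg_near_cst; exists 1%N => // n /= n0.
by apply: birkhoff_avg_cst.
Qed.

Lemma birkhoff_lim_comp x phi : compact [set: X] -> continuous phi -> generic x ->
  birkhoff_lim x (phi \o f) = birkhoff_lim x phi.
Proof.
move=> cX cphi gx; rewrite -(birkhoff_lim_shift cX cphi (gx _ cphi)).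
by rewrite /birkhoff_lim; under [in RHS]eq_fun do rewrite birkhoff_avg_comp.
Qed.

Lemma birkhoff_lim_bound x phi M : continuous phi -> generic x ->
  (forall y, `|phi y| <= M) -> `|birkhoff_lim x phi| <= M.
Proof.
move=> cphi gx hM; have LP := birkhoff_limP gx.
have cc (a : R) : continuous ((fun=> a) : X -> R) by exact: cst_continuous.
rewrite ler_norml; apply/andP; split.
  rewrite -[- M]mulr1 -(birkhoff_lim1 x) -(pfun_cst LP) (pfun_le LP)// => y.
  by have := hM y; rewrite ler_norml => /andP[].
rewrite -[leRHS]mulr1 -(birkhoff_lim1 x) -(pfun_cst LP) (pfun_le LP)// => y.
by have := hM y; rewrite ler_norml => /andP[].
Qed.

Lemma indic_avg_ge0 A n x : 0 <= birkhoff_avg f \1_A n x.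
Proof. exact: birkhoff_avg_ge0. Qed.

Lemma tau_lt x A (c : R) : (tau f x A < c%:E)%E ->
  \forall n \near \oo, birkhoff_avg f \1_A n x < c.
Proof.
move=> /ereal_inf_lt[_ [V Voo <-] h]; apply: filterS Voo => n Vn.
rewrite -lte_fin; apply: le_lt_trans h; apply: ereal_sup_ubound.
by exists n.
Qed.

Lemma tau_le x A (c : R) : (\forall n \near \oo, birkhoff_avg f \1_A n x <= c) ->
  (tau f x A <= c%:E)%E.
Proof.
move=> h; apply: ereal_inf_le; exists (ereal_sup [set (birkhoff_avg f \1_A n x)%:E |
  n in [set n | birkhoff_avg f \1_A n x <= c]]);
    first by exists [set n | birkhoff_avg f \1_A n x <= c].
by apply: ge_ereal_sup => _ [n /= hn <-]; rewrite lee_fin.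
Qed.

Lemma tau_ge0 x A : (0 <= tau f x A)%E.
Proof.
rewrite leNgt; apply/negP => /tau_lt [N _ /(_ N (leqnn N))].
by rewrite ltNge indic_avg_ge0.
Qed.

Lemma tau_le1 x A : (tau f x A <= 1)%E.
Proof.
apply: tau_le; exists 1%N => // n /= n0; rewrite -(birkhoff_avg_cst 1 x n0).
by apply: le_birkhoff_avg => y; rewrite indicE; case: (_ \in _).
Qed.

Lemma tau_fin x A : tau f x A \is a fin_num.
Proof.
by rewrite ge0_fin_numE ?tau_ge0// (le_lt_trans (tau_le1 _ _))// ltry.
Qed.

Lemma tau_le_lim x A phi : generic x -> continuous phi ->
  (forall y, 0 <= phi y) -> (forall y, A y -> 1 <= phi y) ->
  (tau f x A <= (birkhoff_lim x phi)%:E)%E.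
Proof.
move=> gx cphi phi0 phi1; apply/lee_addgt0Pr => e e0; rewrite -EFinD; apply: tau_le.
have /cvgrPdist_lt/(_ _ e0) := gx _ cphi; apply: filterS => n.
rewrite -/(birkhoff_lim x phi) ltr_norml => /andP[h _].
apply: (@le_trans _ _ (birkhoff_avg f phi n x)); last by lra.
apply: le_birkhoff_avg => y; rewrite indicE; have [/set_mem|_] := boolP (y \in A) => //.
exact: phi1.
Qed.

End birkhoff.

(** * Generic points and the total mass of [eta_x] *)

(** A form of the Cauchy criterion: [c] may depend on [e], so no limit has to be guessed. *)
Lemma cvgn_of_near_cst (R : realType) (u : nat -> R) :
  (forall e, 0 < e -> exists c, \forall n \near \oo, `|u n - c| <= e) -> cvgn u.
Proof.
move=> h; apply/cauchy_cvgP/cauchy_exP => e e0.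
have [c hc] := h (e / 2) ltac:(by rewrite divr_gt0).
exists c; apply: filterS hc => n hn; rewrite /ball/= distrC.
by apply: le_lt_trans hn _; rewrite ltr_pdivrMr// ltr_pMr// ltr1n.
Qed.

(** Turns bump functions into a partition of unity: the right-hand side is at most 1 when the [b i]
    lie in [0, 1], and equals 1 wherever some [b i] with i < K does. *)
Lemma sum_mul_prod_compl (R : comPzRingType) (b : nat -> R) K :
  \sum_(0 <= i < K) b i * \prod_(0 <= j < i) (1 - b j) =
  1 - \prod_(0 <= i < K) (1 - b i).
Proof.
elim: K => [|K IHK]; first by rewrite !big_nil subrr.
by rewrite !big_nat_recr//= IHK; ring.
Qed.

(** Pigeonhole: the [N] increments telescope to at most 1. Steps of length two leave the odd index
    2k + 1 in the middle, which is where the balls removed in [generic_nu_r_le] end. *)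
Lemma monotone_small_increment (R : realType) (l : nat -> R) N :
  (0 < N)%N -> (forall k, 0 <= l k <= 1) ->
  exists2 k, (k < N)%N & l k.*2.+2 - l k.*2 <= N%:R^-1.
Proof.
move=> N0 l01; apply/not_exists2P => h.
have : 1 < \sum_(0 <= k < N) (l k.+1.*2 - l k.*2).
  have -> : (1 : R) = \sum_(0 <= k < N) N%:R^-1.
    by rewrite sumr_const_nat subn0 -[RHS]mulr_natr mulVf// pnatr_eq0 -lt0n.
  rewrite !big_mkord; apply: ltr_sum => [|k _].
    by apply/hasP; exists (Ordinal N0) => //; rewrite mem_index_enum.
  by rewrite ltNge; apply/negP => hk; case: (h k) => // ; apply.
rewrite telescope_sumr// => h1.
by have /andP[_ ?] := l01 N.*2; have /andP[? _] := l01 0.*2; lra.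
Qed.

Lemma open_forall_ltn (T : topologicalType) (F : nat -> set T) i :
  (forall j, open (F j)) -> open [set y | forall j, (j < i)%N -> F j y].
Proof.
move=> oF; elim: i => [|i IHi].
  by rewrite (_ : mkset _ = setT); [exact: openT|apply/seteqP].
rewrite (_ : mkset _ = [set y | forall j, (j < i)%N -> F j y] `&` F i).
  exact: openI.
apply/seteqP; split=> [y h|y [h Fy] j]; first by split=> [j ji|]; apply: h => //;
  exact: ltnW.
by rewrite ltnS leq_eqVlt => /predU1P[->//|]; exact: h.
Qed.

Lemma near_forall_ltn (P : nat -> nat -> Prop) K :
  (forall k, \forall n \near \oo, P k n) ->
  \forall n \near \oo, forall k, (k < K)%N -> P k n.
Proof.
move=> h; elim: K => [|K IHK]; first exact: nearW.
near=> n => k; rewrite ltnS leq_eqVlt => /predU1P[->|].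
  by near: n.
by move: k; near: n.
Unshelve. all: by end_near. Qed.

Section eta.
Context {R : realType} {X : pointedMetricType R} (f : X -> X).
Hypothesis cX : compact [set: X].
Implicit Types (phi psi : X -> R) (A : set X) (x : X) (n : nat).

Lemma birkhoff_avg_near_tau x (I : nat -> set X) K (d : R) : 0 < d ->
  \forall n \near \oo, forall k, (k < K)%N ->
    birkhoff_avg f \1_(I k) n x < fine (tau f x (I k)) + d.
Proof.
move=> d0; apply: near_forall_ltn => k; apply: tau_lt.
by rewrite EFinD fineK ?tau_fin// lteDl ?tau_fin// lte_fin.
Qed.

(** At each time n > 0 the visit frequencies of a cover add up to at least 1. It suffices to take a
    time when all [K] of them are below their upper limits plus e / K. *)
Lemma cover_tau_ge1 x (I : nat -> set X) K :
  (forall y, exists2 k, (k < K)%N & I k y) ->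
  1 <= \sum_(0 <= k < K) fine (tau f x (I k)).
Proof.
move=> hK; apply/ler_addgt0Pr => e e0.
have K0 : (0 < K)%N by have [k] := hK point; case: (K).
pose d := e / K%:R.
have d0 : 0 < d by rewrite divr_gt0// ltr0n.
have [n [h n0]] : exists n, (forall k, (k < K)%N ->
    birkhoff_avg f \1_(I k) n x < fine (tau f x (I k)) + d) /\ (0 < n)%N.
  have [N _ hN] := birkhoff_avg_near_tau x I K d0.
  by exists N.+1; split => //; apply: hN => /=.
apply: (@le_trans _ _ (\sum_(0 <= k < K) birkhoff_avg f \1_(I k) n x)).
  rewrite -birkhoff_avg_sum -(birkhoff_avg_cst f 1 x n0).
  apply: le_birkhoff_avg => y; have [k kK Iky] := hK y.
  rewrite big_mkord (bigD1 (Ordinal kK))//= indicE mem_set//=.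
  by rewrite lerDl sumr_ge0.
have -> : e = \sum_(0 <= k < K) d.
  by rewrite sumr_const_nat subn0 -[RHS]mulr_natr divfK// pnatr_eq0 -lt0n.
by rewrite -big_split/= !big_mkord ler_sum// => k _; exact/ltW/h.
Qed.

Lemma nneseries_tau_ge1 x (I : nat -> set X) : (forall k, open (I k)) ->
  [set: X] `<=` \bigcup_k I k ->
  exists2 K, (forall y, exists2 k, (k < K)%N & I k y) &
    ((\sum_(0 <= k < K) fine (tau f x (I k)))%:E <= \sum_(k <oo) tau f x (I k))%E.
Proof.
move=> oI cov; have [K hK] := compact_nat_subcover cX oI cov.
exists K => //; rewrite -sumEFin.
under eq_bigr do rewrite fineK ?tau_fin//.
by apply: nneseries_lim_ge => k _ _; exact: tau_ge0.
Qed.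

Lemma eta_ge1 x : (1 <= eta_x f x [set: X])%E.
Proof.
apply: (@le_trans _ _ (nu_r f x 1 setT)); last first.
  by apply: ereal_sup_ubound; exists 1 => //=; exact: ltr01.
apply: le_ereal_inf_tmp => _ [I [oI cov] <-].
have [K hK] := nneseries_tau_ge1 x (fun k => (oI k).1) cov.
by apply: le_trans; rewrite lee_fin cover_tau_ge1.
Qed.

(** Upper frequencies only bound from above, but the sets [A k] partition [X], so their frequencies
    [a k] add up to exactly 1. As a k < t k + d while the [t k] sum to less than 1 + e2, a large
    deficit at one index would need an excess elsewhere: the total of |a k - t k| is at most 3 *
    e2. *)
Lemma eta_eq1_generic x : eta_x f x [set: X] = 1%E -> generic f x.
Proof.
move=> eta1 phi cphi; apply: cvgn_of_near_cst => e e0.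
have [M M0 hM] := compact_continuous_bounded cX cphi.
(* With this [e2] the frequency error 3 * e2, weighted by the bound [M] of [phi], is exactly
   [e1]. *)
pose e1 := e / 2; pose e2 := e / (6 * M).
have e10 : 0 < e1 by rewrite divr_gt0.
have e20 : 0 < e2 by rewrite divr_gt0// mulr_gt0.
have [r r0 hr] := compact_uniform_continuity cX cphi e10.
(* Scale r / 2 because diameters are bounded by a weak inequality and uniform continuity at [r]
   wants a strict one. *)
have : (nu_r f x (r / 2) setT < (1 + e2)%:E)%E.
  apply: (@le_lt_trans _ _ 1%E); last by rewrite lte_fin ltrDl.
  by rewrite -eta1; apply: ereal_sup_ubound; exists (r / 2) => //=; rewrite divr_gt0.
move=> /ereal_inf_lt[_ [I [oI cov] <-]] hsum.
have [K hK /le_lt_trans/(_ hsum)] := nneseries_tau_ge1 x (fun k => (oI k).1) cov.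
rewrite lte_fin; set t := fun k => fine (tau f x (I k)).
rewrite -/(\sum_(0 <= k < K) t k) => tsum.
have K0 : (0 < K)%N by have [k] := hK point; case: (K).
pose d := e2 / K%:R.
have d0 : 0 < d by rewrite divr_gt0// ltr0n.
have dsum : \sum_(0 <= k < K) d = e2.
  by rewrite sumr_const_nat subn0 -[LHS]mulr_natr divfK// pnatr_eq0 -lt0n.
pose A k : set X := I k `\` \bigcup_(j in `I_k) I j.
have Asum y : \sum_(0 <= k < K) (\1_(A k) y : R) = 1 /\
    exists2 k, (k < K)%N & A k y.
  have ex : exists k, `[< I k y >] by have [k _ Iky] := hK y; exists k; apply/asboolP.
  case: (ex_minnP ex) => k /asboolP Iky kmin.
  have kK : (k < K)%N.
    by have [j jK Ijy] := hK y; apply: leq_ltn_trans jK; apply: kmin; apply/asboolP.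
  have Aky : A k y.
    split=> // -[j /= jk Ijy].
    by have := kmin j (introT (asboolP _) Ijy); rewrite leqNgt jk.
  split; [|by exists k].
  rewrite big_mkord (bigD1 (Ordinal kK))//= indicE mem_set// big1 ?addr0// => j jk.
  rewrite indicE memNset// => -[Ijy nj]; move/negP: jk; apply; apply/eqP/val_inj => /=.
  apply/eqP; rewrite eqn_leq kmin ?andbT; last exact/asboolP.
  by rewrite leqNgt; apply/negP => kj; apply: nj; exists k.
(* A sample value of [phi] on [I k]; for empty [I k] the default 0 still respects the bound [M]. *)
pose c k : R := if pselect (exists y, I k y) is left h then phi (projT1 (cid h)) else 0.
have cM k : `|c k| <= M.
  by rewrite /c; case: pselect => // _; rewrite normr0 ltW.
have cphiI k y : I k y -> `|phi y - c k| <= e1.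
  move=> Iky; rewrite /c; case: pselect => [h|]; last by case; exists y.
  case: cid => z Ikz /=; apply/ltW/hr; apply: le_lt_trans ((oI k).2 _ _ Iky Ikz) _.
  by rewrite ltr_pdivrMr// ltr_pMr// ltr1n.
exists (\sum_(0 <= k < K) c k * t k).
near=> n.
have han : forall k, (k < K)%N ->
    birkhoff_avg f \1_(I k) n x < fine (tau f x (I k)) + d.
  by near: n; exact: birkhoff_avg_near_tau.
have n0 : (0 < n)%N by near: n; exists 1%N.
pose a k := birkhoff_avg f \1_(A k) n x.
have alt k : (k < K)%N -> a k < t k + d.
  move=> kK; apply: le_lt_trans (han _ kK); apply: le_birkhoff_avg => y.
  rewrite !indicE; have [/set_mem[Iky _]|//] := boolP (y \in A k).
  by rewrite mem_set.
have asum : \sum_(0 <= k < K) a k = 1.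
  rewrite -birkhoff_avg_sum -[RHS](birkhoff_avg_cst f 1 x n0).
  by congr (birkhoff_avg f _ n x); apply/funext => y; exact: (Asum y).1.
have h1 : `|birkhoff_avg f phi n x - \sum_(0 <= k < K) c k * a k| <= e1.
  under eq_bigr do rewrite -birkhoff_avgZ.
  rewrite -birkhoff_avg_sum; apply: birkhoff_avg_dist; first exact: ltW.
  move=> y; have [s1 [k kK Aky]] := Asum y.
  have -> : phi y - \sum_(0 <= j < K) c j * \1_(A j) y =
      \sum_(0 <= j < K) (phi y - c j) * \1_(A j) y.
    by rewrite -[in LHS](mulr1 (phi y)) -s1 mulr_sumr -sumrB;
      apply: eq_bigr => j _; rewrite mulrBl.
  rewrite (le_trans (ler_norm_sum _ _ _))// -[leRHS]mulr1 -s1 mulr_sumr.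
  apply: ler_sum => j _; rewrite indicE.
  have [/set_mem[Ijy _]|_] := boolP (y \in A j); last by rewrite !mulr0 normr0.
  by rewrite !mulr1 cphiI.
have h2 : `|\sum_(0 <= k < K) c k * a k - \sum_(0 <= k < K) c k * t k| <= e1.
  rewrite -sumrB (le_trans (ler_norm_sum _ _ _))//.
  apply: (@le_trans _ _ (\sum_(0 <= k < K) M * ((t k + d - a k) + d))).
    rewrite !big_mkord; apply: ler_sum => k _; rewrite -mulrBr normrM ler_pM// ler_norml.
    have := alt k (ltn_ord k) => ?.
    by apply/andP; split; lra.
  rewrite -mulr_sumr big_split/= sumrB big_split/= dsum asum.
  have -> : e1 = M * (3 * e2) by rewrite /e1 /e2; field; rewrite gt_eqF.
  by rewrite ler_pM2l//; lra.
rewrite (_ : _ - _ = (birkhoff_avg f phi n x - \sum_(0 <= k < K) c k * a k) +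
  (\sum_(0 <= k < K) c k * a k - \sum_(0 <= k < K) c k * t k)); last by ring.
by rewrite (le_trans (ler_normD _ _))// [e](_ : e = e1 + e1) ?lerD// /e1; lra.
Unshelve. all: by end_near. Qed.

Lemma tau_set0 x : tau f x set0 = 0%E.
Proof.
apply/eqP; rewrite eq_le tau_ge0 andbT; apply: tau_le; apply: nearW => n.
by rewrite /birkhoff_avg big1 ?mulr0// => j _; rewrite indicE in_set0.
Qed.

(* The cover consists of balls from which the slightly smaller previous balls
   are removed; by pigeonhole the radii can be chosen so that the overlaps have
   small mass. *)
Lemma generic_nu_r_le x (r e : R) : generic f x -> 0 < r -> 0 < e ->
  (nu_r f x r setT <= (1 + e)%:E)%E.
Proof.
move=> gx r0 e0; have LP := birkhoff_limP gx.
set L := birkhoff_lim f x in LP.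
(* The balls used below have radius at most 2 * rho = r / 2, hence diameter at most [r]. *)
pose rho := r / 4; have rho0 : 0 < rho by rewrite divr_gt0.
have [K [s hs]] := compact_finite_net cX rho0.
pose N := (Num.bound (K%:R / e)).+1.
have NR0 : 0 < N%:R :> R by rewrite ltr0n.
have KN : K%:R * N%:R^-1 <= e.
  rewrite ler_pdivrMr// mulrC -ler_pdivrMr//.
  rewrite (le_trans (ltW (archi_boundP _)))//; first by rewrite divr_ge0// ltW.
  by rewrite ler_nat.
(* The annulus between radii [rho] and 2 * rho is divided into 2N rings of width [w]; [t i] counts
   rings, from 0 at radius [rho] to 2N at radius 2 * rho. *)
pose w := rho / (N.*2)%:R.
have w0 : 0 < w by rewrite divr_gt0// ltr0n double_gt0.
pose t i y := (mdist (s i) y - rho) / w.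
have ct i : continuous (t i).
  move=> y; apply: cvgM; last exact: cvg_cst.
  by apply: cvgB; [exact: mdist_continuous|exact: cvg_cst].
(* [G i k] is 1 up to ring coordinate k and 0 from k + 1 on. *)
pose G i k y : R := clamp (k.+1%:R - t i y).
have cG i k : continuous (G i k).
  by apply: continuous_clamp => y; apply: cvgB; [exact: cvg_cst|exact: ct].
have G0 i k y : 0 <= G i k y by exact: clamp_ge0.
have G1 i k y : G i k y <= 1 by exact: clamp_le1.
have Gle i k y : G i k y <= G i k.+2 y.
  by apply: le_clamp; rewrite lerD2r ler_nat; apply: leqW; exact: leqW.
have c1 : continuous ((fun=> 1) : X -> R) by exact: cst_continuous.
have L1 : L (fun=> 1) = 1 by exact: birkhoff_lim1.
have /choice[k hk] i : exists k, (k < N)%N /\ L (G i k.*2.+2) - L (G i k.*2) <= N%:R^-1.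
  have [//|k|k kN hk] := @monotone_small_increment R (fun k => L (G i k)) N.
    by rewrite (pfun_ge0 LP)//= -L1 (pfun_le LP).
  by exists k.
pose V i : set X := if (i < K)%N then
  [set y | t i y < (k i).*2.+2%:R] `&`
  [set y | forall j, (j < i)%N -> (k j).*2.+1%:R < t j y] else set0.
have oV i : open (V i).
  rewrite /V; case: ifP => _; last exact: open0.
  apply: openI.
    by apply: (@open_comp _ _ (t i) [set z | z < (k i).*2.+2%:R]) => [y _|];
      [exact: ct|exact: open_lt].
  apply: (@open_forall_ltn _ (fun j => [set y | (k j).*2.+1%:R < t j y])) => j.
  by apply: (@open_comp _ _ (t j) [set z | (k j).*2.+1%:R < z]) => [y _|];
    [exact: ct|exact: open_gt].
have dV i : diam_le (V i) r.
  have ball y : V i y -> mdist (s i) y < r / 2.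
    rewrite /V; case: ifP => // _ [/= ty _].
    have : t i y < N.*2%:R.
      apply: (lt_le_trans ty); rewrite ler_nat -doubleS leq_double; exact: (hk i).1.
    rewrite /t ltr_pdivrMr// /w mulrCA divff ?mulr1; last first.
      by rewrite pnatr_eq0 double_eq0.
    by rewrite /rho; lra.
  move=> y z /ball by_ /ball bz; have := metric_triangle y (s i) z.
  by rewrite [mdist y (s i)]metric_sym; lra.
have covV : [set: X] `<=` \bigcup_i V i.
  (* Take the least [i] whose large ball contains [y]: for j < i, minimality gives t j y >= 2 * k j
     + 2, so [y] was not removed. *)
  move=> y _; have ex : exists i, (i < K)%N && (t i y < (k i).*2.+2%:R).
    have [i iK yi] := hs y; exists i; rewrite iK/=.
    apply: (@lt_trans _ _ 0); last by rewrite ltr0n.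
    by rewrite /t pmulr_llt0 ?invr_gt0// subr_lt0.
  case: (ex_minnP ex) => i /andP[iK ti] imin; exists i => //; rewrite /V iK;
    split=> // j ji.
  rewrite ltNge; apply/negP => tj.
  have := imin j; rewrite (ltn_trans ji iK)/= leqNgt ji/=.
  by rewrite (le_lt_trans tj) ?ltr_nat// => /(_ isT).
(* A continuous function equal to 1 on [V i] for i < K: the first factor is 1 on the large ball, and
   each [G j (k j).*2] vanishes beyond coordinate 2 * k j + 1. *)
pose chi i y := G i (k i).*2.+2 y * \prod_(0 <= j < i) (1 - G j (k j).*2 y).
have cchi i : continuous (chi i).
  move=> y; apply: cvgM; first exact: cG.
  apply: (@continuous_prod R X _ _ _ (fun j y => 1 - G j (k j).*2 y)) => j z.
  by apply: cvgB; [exact: cvg_cst|exact: cG].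
have prod01 i y : 0 <= \prod_(0 <= j < i) (1 - G j (k j).*2 y) <= 1.
  elim: i => [|i /andP[p0 p1]]; first by rewrite big_nil ler01 lexx.
  have := G0 i (k i).*2 y; have := G1 i (k i).*2 y => g1 g0.
  by rewrite big_nat_recr//= mulr_ge0 ?mulr_ile1//; lra.
have chi0 i y : 0 <= chi i y by rewrite mulr_ge0//; case/andP: (prod01 i y).
have tauV i : (tau f x (V i) <= (L (chi i))%:E)%E.
  apply: tau_le_lim => // y; rewrite /V; case: ifP => // _ [/= ti tj].
  rewrite /chi /G clamp_eq1; last by rewrite -natr1; lra.
  rewrite mul1r big_mkord big1// => j _.
  by rewrite clamp_eq0 ?subr0//; have := tj _ (ltn_ord j); lra.
(* Replacing the outer cut-off in [chi i] by the inner one gives a sum at most 1, by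
   [sum_mul_prod_compl]. The [K] differences were chosen to have mass at most 1 / N each, hence at
   most [e] together. *)
have sumchi y : \sum_(0 <= i < K) chi i y <=
    1 + \sum_(0 <= i < K) (G i (k i).*2.+2 y - G i (k i).*2 y).
  have -> : \sum_(0 <= i < K) chi i y =
      \sum_(0 <= i < K) G i (k i).*2 y * \prod_(0 <= j < i) (1 - G j (k j).*2 y) +
      \sum_(0 <= i < K) (G i (k i).*2.+2 y - G i (k i).*2 y) *
         \prod_(0 <= j < i) (1 - G j (k j).*2 y).
    by rewrite -big_split/=; apply: eq_bigr => i _; rewrite -mulrDl addrC subrK.
  rewrite sum_mul_prod_compl; apply: lerD.
    by have /andP[? _] := prod01 K y; lra.
  apply: ler_sum => i _; rewrite ler_piMr ?subr_ge0//; by case/andP: (prod01 i y).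
have sumL : \sum_(0 <= i < K) L (chi i) <= 1 + e.
  rewrite -(pfun_sum LP)//.
  have cD i : continuous (fun y => G i (k i).*2.+2 y - G i (k i).*2 y).
    by move=> y; apply: cvgB; exact: cG.
  have cS := @continuous_sum R X _ (index_iota 0 K) xpredT _ cD.
  apply: (le_trans (pfun_le LP _ _ sumchi)).
    exact: continuous_sum.
    by move=> y; apply: cvgD; [exact: cvg_cst|exact: cS].
  rewrite (pfunD LP)// L1 lerD2l (pfun_sum LP)//.
  apply: (le_trans _ KN); rewrite mulr_natl -[K in leRHS]subn0 -sumr_const_nat.
  by apply: ler_sum => i _; rewrite (pfunB LP)//; exact: (hk i).2.
apply: (@le_trans _ _ (\sum_(i <oo) tau f x (V i))%E).
  by apply: ereal_inf_lbound; exists V.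
rewrite (@nneseries_split _ _ 0%N K); last by move=> i _; exact: tau_ge0.
rewrite add0n (@eseries0 _ _ K) ?adde0; last first.
  by move=> i Ki _; rewrite /V ltnNge Ki/= tau_set0.
apply: (@le_trans _ _ (\sum_(0 <= i < K) (L (chi i))%:E)%E).
  by apply: lee_sum.
by rewrite sumEFin lee_fin.
Qed.

Lemma eta_eq1P x : eta_x f x [set: X] = 1%E <-> generic f x.
Proof.
split=> [|gx]; first exact: eta_eq1_generic.
apply/eqP; rewrite eq_le eta_ge1 andbT; apply: ge_ereal_sup => _ [r /= r0 <-].
by apply/lee_addgt0Pr => e e0; rewrite -EFinD; exact: generic_nu_r_le.
Qed.

End eta.

(** * Measurability of the set of generic points *)

(** At each scale [rho m], bumps around a finite net give a partition of unity whose pieces live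
    within 2 * rho m of their centres. The coefficients are the values of [phi] at these centres,
    and uniform continuity bounds the error. *)
Lemma countable_approximating_family (R : realType) (X : pointedMetricType R) :
  compact [set: X] -> exists p : nat -> nat -> X -> R,
    (forall m i, continuous (p m i)) /\
    forall phi : X -> R, continuous phi -> forall e, 0 < e ->
      exists m K (c : nat -> R), forall y,
        `|phi y - \sum_(0 <= i < K) c i * p m i y| <= e.
Proof.
move=> cX; pose rho m : R := m.+1%:R^-1.
have rho0 m : 0 < rho m by rewrite invr_gt0 ltr0n.
have /choice[K /choice[s hs]] m := compact_finite_net cX (rho0 m).
pose b m i y : R := clamp (2 - mdist (s m i) y / rho m).
have cb m i : continuous (b m i).
  apply: continuous_clamp => y; apply: cvgB; first exact: cvg_cst.
  by apply: cvgM; [exact: mdist_continuous|exact: cvg_cst].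
exists (fun m i y => b m i y * \prod_(0 <= j < i) (1 - b m j y)); split.
  move=> m i y; apply: cvgM; first exact: cb.
  apply: (@continuous_prod R X _ _ _ (fun j y => 1 - b m j y)) => j z.
  by apply: cvgB; [exact: cvg_cst|exact: cb].
move=> phi cphi e e0; have [d d0 hd] := compact_uniform_continuity cX cphi e0.
have [m hm] : exists m, 2 * rho m < d.
  have d20 : 0 < d / 2 by rewrite divr_gt0.
  have [m _ /(_ m (leqnn m))] := near_infty_natSinv_lt (PosNum d20).
  by rewrite /= ltr_pdivlMr// mulrC; exists m.
exists m, (K m), (phi \o s m) => y.
set p := fun i => b m i y * \prod_(0 <= j < i) (1 - b m j y).
have p0 i : 0 <= p i.
  rewrite mulr_ge0 ?clamp_ge0// prodr_ge0// => j _; by rewrite subr_ge0 clamp_le1.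
have psum : \sum_(0 <= i < K m) p i = 1.
  rewrite sum_mul_prod_compl; have [i iK yi] := hs m y.
  rewrite big_mkord (bigD1 (Ordinal iK))//= [b _ _ _]clamp_eq1 ?subrr ?mul0r ?subr0//.
  by rewrite lerBrDl -lerBrDr -[_ - 1]/(2 - 1 : R) ler_pdivrMr//; lra.
have -> : phi y - \sum_(0 <= i < K m) (phi \o s m) i * p i =
    \sum_(0 <= i < K m) (phi y - phi (s m i)) * p i.
  rewrite -[in LHS](mulr1 (phi y)) -psum mulr_sumr -sumrB.
  by apply: eq_bigr => j _; rewrite mulrBl.
rewrite (le_trans (ler_norm_sum _ _ _))// -[leRHS]mulr1 -psum mulr_sumr.
apply: ler_sum => i _; rewrite normrM (ger0_norm (p0 i)).
have [yi|yi] := ltP (mdist (s m i) y) (2 * rho m).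
  rewrite ler_wpM2r// ltW// distrC; apply: hd; exact: lt_trans hm.
suff -> : p i = 0 by rewrite !mulr0.
by rewrite /p [b _ _ _]clamp_eq0 ?mul0r// subr_le0 ler_pdivlMr.
Qed.

(** * Families of functions that determine genericity and limits *)

Section determining.
Context {R : realType} {X : pointedMetricType R} (f : X -> X).
Hypotheses (cX : compact [set: X]) (cf : continuous f).
Variable p : nat -> nat -> X -> R.
Hypothesis cp : forall m i, continuous (p m i).
Hypothesis approx : forall phi : X -> R, continuous phi -> forall e, 0 < e ->
  exists m K (c : nat -> R), forall y, `|phi y - \sum_(0 <= i < K) c i * p m i y| <= e.

Let continuous_comb m K (c : nat -> R) :
  continuous (fun y => \sum_(0 <= i < K) c i * p m i y).
Proof.
apply: (@continuous_sum R X _ _ _ (fun i y => c i * p m i y)) => i y.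
by apply: cvgM; [exact: cvg_cst|exact: cp].
Qed.

Lemma generic_of_family x :
  (forall m i, cvgn (fun n => birkhoff_avg f (p m i) n x)) -> generic f x.
Proof.
move=> h phi cphi; apply: cvgn_of_near_cst => e e0.
have e20 : 0 < e / 2 by rewrite divr_gt0.
have [m [K [c hc]]] := approx cphi e20.
exists (\sum_(0 <= i < K) c i * birkhoff_lim f x (p m i)).
have cv : (fun n => \sum_(0 <= i < K) c i * birkhoff_avg f (p m i) n x) @ \oo -->
    \sum_(0 <= i < K) c i * birkhoff_lim f x (p m i).
  apply: cvg_big; first exact: add_continuous.
  by move=> i _; apply: cvgM; [exact: cvg_cst|exact: h].
have /cvgrPdist_lt/(_ _ e20) := cv; apply: filterS => n hn.
have := birkhoff_avg_dist f n x (ltW e20) hc.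
rewrite birkhoff_avg_sum; under eq_bigr do rewrite birkhoff_avgZ.
move: hn; set a := \sum_(0 <= i < K) _; set a' := \sum_(0 <= i < K) _ => hn h1.
rewrite -[_ - _](subrKA a') (le_trans (ler_normD _ _))// [e]splitr lerD//.
by rewrite distrC ltW.
Qed.

Lemma birkhoff_lim_family x x' : generic f x -> generic f x' ->
  (forall m i, birkhoff_lim f x (p m i) = birkhoff_lim f x' (p m i)) ->
  forall phi, continuous phi -> birkhoff_lim f x phi = birkhoff_lim f x' phi.
Proof.
move=> gx gx' h phi cphi; apply/eqP; rewrite -subr_eq0 -normr_le0.
apply/ler_addgt0Pr => e e0; rewrite add0r.
have e20 : 0 < e / 2 by rewrite divr_gt0.
have [m [K [c hc]]] := approx cphi e20.
have cS := @continuous_comb m K c.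
have cD : continuous (fun y => phi y - \sum_(0 <= i < K) c i * p m i y).
  by move=> y; apply: cvgB; [exact: cphi|exact: cS].
have := birkhoff_lim_bound cD gx hc; have := birkhoff_lim_bound cD gx' hc.
have LP := birkhoff_limP gx; have LP' := birkhoff_limP gx'.
rewrite (pfunB LP)// (pfunB LP')//.
have -> : birkhoff_lim f x (fun y => \sum_(0 <= i < K) c i * p m i y) =
    birkhoff_lim f x' (fun y => \sum_(0 <= i < K) c i * p m i y).
  have cc i : continuous (fun y => c i * p m i y).
    by move=> y; apply: cvgM; [exact: cvg_cst|exact: cp].
  rewrite (pfun_sum LP)// (pfun_sum LP')//; apply: eq_bigr => i _.
  by rewrite (pfunZ LP)// (pfunZ LP')// h.
set a := birkhoff_lim f x' (fun y => \sum_(0 <= i < K) _) => h1 h2.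
rewrite -[_ - _](subrKA a) (le_trans (ler_normD _ _))// [e]splitr lerD//.
by rewrite distrC.
Qed.

(** The Cauchy criterion with errors 1/(k+1) writes the set through countable unions and
    intersections of conditions on continuous functions. *)
Lemma measurable_cvgn_birkhoff phi : continuous phi ->
  measurable ([set x | cvgn (fun n => birkhoff_avg f phi n x)] : set (borel X)).
Proof.
move=> cphi; pose u n x := birkhoff_avg f phi n x.
have cu n : continuous (u n) by exact: continuous_birkhoff_avg.
have -> : [set x | cvgn (fun n => birkhoff_avg f phi n x)] =
    \bigcap_k \bigcup_N \bigcap_n
      [set x | (N <= n)%N -> `|u n x - u N x| <= k.+1%:R^-1].
  apply/seteqP; split=> x /= => [cx k _|h].
    have k0 : 0 < (k.+1%:R^-1 : R) / 2 by rewrite divr_gt0// invr_gt0 ltr0n.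
    have /cvgrPdist_lt/(_ _ k0)[N _ hN] := cx; exists N => // n _ /= Nn.
    have := hN _ Nn; have := hN N (leqnn N) => /=; rewrite -/(u N x) -/(u n x).
    move=> h1 h2; rewrite -[_ - _](subrKA (limn (u^~ x))) [leRHS]splitr.
    by rewrite (le_trans (ler_normD _ _))// lerD// ltW// distrC.
  apply: cvgn_of_near_cst => e e0.
  have [k _ /(_ k (leqnn k))/= ke] := near_infty_natSinv_lt (PosNum e0).
  have [N _ hN] := h k Logic.I; exists (u N x); exists N => // n /= Nn.
  exact: le_trans (hN n Logic.I Nn) (ltW ke).
apply: bigcapT_measurable => k; apply: bigcupT_measurable => N.
apply: bigcapT_measurable => n; have [Nn|nN] := leqP N n; last first.
  rewrite (_ : mkset _ = setT); first exact: measurableT.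
  by apply/seteqP; split=> // x _ /=.
have ch : continuous (fun x => `|u n x - u N x|).
  move=> y; apply: cvg_norm; apply: cvgB; exact: cu.
have := continuous_measurable_borel ch;
  move=> /(_ measurableT _ (measurable_itv `]-oo, k.+1%:R^-1])).
rewrite setTI; congr measurable; apply/seteqP; split=> x /=; rewrite in_itv//=.
exact.
Qed.

Lemma measurable_generic : measurable ([set x | generic f x] : set (borel X)).
Proof.
have -> : [set x | generic f x] =
    \bigcap_m \bigcap_i [set x | cvgn (fun n => birkhoff_avg f (p m i) n x)].
  apply/seteqP; split=> x /= => [gx m _ i _ /=|h]; first exact: gx.
  by apply: generic_of_family => m i; exact: h.
apply: bigcapT_measurable => m; apply: bigcapT_measurable => i.
exact: measurable_cvgn_birkhoff.
Qed.

End determining.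

(** * Physical measures *)

Section main.
Context {R : realType} {X : pointedMetricType R} (f : X -> X).
Hypotheses (cX : compact [set: X]) (cf : continuous f).
Variable mu : {measure set (borel X) -> \bar R}.
Hypothesis mufin : (mu [set: borel X] < +oo)%E.
Let G : set (borel X) := [set x | generic f x].

Lemma measurable_genericT : measurable G.
Proof.
have [p [cp approx]] := countable_approximating_family cX.
exact: (measurable_generic cf cp approx).
Qed.
Let mG := measurable_genericT.

Lemma measurable_birkhoff_lim (phi : X -> R) : continuous phi ->
  measurable_fun G (birkhoff_lim f ^~ phi : borel X -> R).
Proof.
move=> cphi.
apply: (@measurable_fun_cvg _ (borel X) R G
  (fun n x => birkhoff_avg f phi n x)) => [n|x gx].
  apply: measurable_funTS; apply: continuous_measurable_borel.
  exact: continuous_birkhoff_avg.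
exact: gx.
Qed.

Lemma integrable_birkhoff_lim (phi : X -> R) : continuous phi ->
  mu.-integrable G (fun x => (birkhoff_lim f x phi)%:E).
Proof.
move=> cphi; have [M M0 hM] := compact_continuous_bounded cX cphi.
apply: (@measurable_bounded_integrable _ (borel X) R mu (birkhoff_lim f ^~ phi)) => //.
- by apply: le_lt_trans mufin; apply: le_measure; rewrite ?inE.
- exact: measurable_birkhoff_lim.
- exists M; split=> [|b Mb x gx]; first exact: num_real.
  exact: le_trans (birkhoff_lim_bound cphi gx hM) (ltW Mb).
Qed.

Definition mean_birkhoff_lim (phi : X -> R) : R :=
  fine (\int[mu]_(x in G) (birkhoff_lim f x phi)%:E)%E.

Lemma mean_birkhoff_limE (phi : X -> R) : continuous phi ->
  ((mean_birkhoff_lim phi)%:E = \int[mu]_(x in G) (birkhoff_lim f x phi)%:E)%E.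
Proof.
move=> cphi; rewrite /mean_birkhoff_lim fineK//.
by apply: integrable_fin_num => //; exact: integrable_birkhoff_lim.
Qed.

Lemma mean_birkhoff_limP : positive_functional mean_birkhoff_lim.
Proof.
split=> [phi psi cphi cpsi|a phi cphi|phi cphi phi0].
- apply: EFin_inj; rewrite EFinD !mean_birkhoff_limE//; last first.
    by move=> y; apply: cvgD; [exact: cphi|exact: cpsi].
  rewrite -integralD//; [|exact: integrable_birkhoff_lim|exact: integrable_birkhoff_lim].
  apply: eq_integral => x /set_mem gx; rewrite -EFinD; congr EFin.
  exact: (pfunD (birkhoff_limP gx)).
- apply: EFin_inj; rewrite EFinM !mean_birkhoff_limE//; last first.
    by move=> y; apply: cvgM; [exact: cvg_cst|exact: cphi].
  rewrite -integralZl//; last exact: integrable_birkhoff_lim.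
  apply: eq_integral => x /set_mem gx; rewrite -EFinM; congr EFin.
  exact: (pfunZ (birkhoff_limP gx)).
- rewrite -lee_fin mean_birkhoff_limE//; apply: integral_ge0 => x gx.
  by rewrite lee_fin (pfun_ge0 (birkhoff_limP gx)).
Qed.

Lemma gen_mu_physical_exists : (0 < mu G)%E ->
  exists nu0 : {measure set (borel X) -> \bar R}, gen_mu_physical f mu nu0.
Proof.
move=> muG; exists (riesz_measure mean_birkhoff_limP); split.
  apply: riesz_measure_invariant => // phi cphi.
  congr fine; apply: eq_integral => x /set_mem gx; congr EFin.
  exact: birkhoff_lim_comp.
exists G; split=> //; split=> // phi cphi; split=> [x gx|]; first exact: gx.
by rewrite riesz_integral// mean_birkhoff_limE.
Qed.

(** The set [U] of the definition consists of generic points. *)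
Lemma gen_mu_physical_generic (nu0 : {measure set (borel X) -> \bar R}) :
  gen_mu_physical f mu nu0 -> (0 < mu G)%E.
Proof.
move=> [_ [U [mU [muU h]]]]; apply: (lt_le_trans muU); apply: le_measure; rewrite ?inE//.
by move=> x Ux phi cphi; exact: (h _ cphi).1.
Qed.

(** By ergodicity one of [E i] and its complement is conull. The intersection of these conull
    choices is conull by countability, and on it membership in each [E i] is constant. *)
Lemma ergodic_conull_family (I : countType) (E : I -> set (borel X)) :
  ergodic f mu -> (forall i, measurable (E i)) -> (forall i, f @^-1` (E i) = E i) ->
  exists U : set (borel X), [/\ measurable U, mu (~` U) = 0%E &
    forall i x y, U x -> U y -> E i x -> E i y].
Proof.
move=> erg mE invE.
pose S i := if mu (E i) == 0%E then ~` E i else E i.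
have mS i : measurable (S i).
  by rewrite /S; case: ifP => _ //; exact: measurableC.
have muS i : mu (~` S i) = 0%E.
  rewrite /S; case: ifP => [/eqP E0|/eqP E0]; first by rewrite setCK.
  by have [] := erg _ (mE i) (invE i).
pose T n := if unpickle n is Some i then S i else setT.
have mT n : measurable (T n) by rewrite /T; case: unpickle.
exists (\bigcap_n T n); split.
- exact: bigcapT_measurable.
- apply: measure_negligible; first exact/measurableC/bigcapT_measurable.
  rewrite setC_bigcap; apply: negligible_bigcup => n.
  apply/negligibleP; first exact: measurableC.
  rewrite /T; case: unpickle => [i|]; first exact: muS.
  by rewrite setCT measure0.
- move=> i x y Ux Uy; have := Ux (pickle i) Logic.I; have := Uy (pickle i) Logic.I.
  by rewrite /T pickleK /S; case: ifP.
Qed.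

Lemma mu_physical_exists : ergodic f mu -> (0 < mu G)%E ->
  exists nu0 : {measure set (borel X) -> \bar R}, mu_physical f mu nu0.
Proof.
move=> erg muG; have [p [cp approx]] := countable_approximating_family cX.
have invG x : G (f x) <-> G x by exact: generic_shift.
(* Rational levels keep the family countable and still separate distinct limits; the index [None]
   stands for [G] itself. *)
pose E (z : option (nat * nat * rat)) : set (borel X) :=
  if z is Some (m, i, q) then [set x | G x /\ birkhoff_lim f x (p m i) <= ratr q] else G.
have mE z : measurable (E z).
  case: z => [[[m i] q]|] //=.
  rewrite (_ : mkset _ = G `&` (birkhoff_lim f ^~ (p m i) :
    borel X -> R) @^-1` `]-oo, ratr q]).
    exact: (measurable_birkhoff_lim (cp m i) mG).
  by apply/seteqP; split=> x /=; rewrite in_itv.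
have invE z : f @^-1` (E z) = E z.
  case: z => [[[m i] q]|]; apply/seteqP; split=> x /=.
  - by move=> [/(invG x).1 gx]; rewrite birkhoff_lim_shift//; exact: gx.
  - by move=> [gx]; rewrite invG birkhoff_lim_shift//; exact: gx.
  - exact: (invG x).1.
  - exact: (invG x).2.
have [U [mU muCU hU]] := ergodic_conull_family erg mE invE.
have muCG : mu (~` G) = 0%E.
  have [G0|//] := erg _ mG (invE None).
  by move: muG; rewrite G0 ltxx.
have mUG : measurable (U `&` G) by exact: measurableI.
have muUG : (0 < mu (U `&` G))%E.
  rewrite lt0e measure_ge0 andbT; apply/eqP => UG0.
  have : (mu G <= mu (U `&` G) + mu (~` U))%E.
    rewrite -measureU//; [|exact: measurableC|].
      apply: le_measure; rewrite ?inE//; first by apply: measurableU => //;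
        exact: measurableC.
      by move=> x gx; have [Ux|] := pselect (U x); [left|right].
    by apply/seteqP; split=> x // [[Ux _]].
  by rewrite UG0 muCU adde0 leNgt muG.
have [x0 [Ux0 gx0]] : exists x0, (U `&` G) x0.
  apply/set0P/eqP => UG0; by move: muUG; rewrite UG0 measure0 ltxx.
have LP := birkhoff_limP gx0.
exists (riesz_measure LP); split.
  by apply: riesz_measure_invariant => // phi cphi; exact: birkhoff_lim_comp.
exists (U `&` G); split=> //; split=> // phi cphi x [Ux gx].
rewrite riesz_integral//.
have -> : birkhoff_lim f x0 phi = birkhoff_lim f x phi.
  apply: (birkhoff_lim_family cp approx) => // m i.
  (* Were the limit at [x1] smaller than at [x2], a rational strictly between them would give a
     sublevel set containing [x1] but not [x2]. *)
  have le x1 x2 : (U `&` G) x1 -> (U `&` G) x2 ->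
      birkhoff_lim f x2 (p m i) <= birkhoff_lim f x1 (p m i).
    move=> [Ux1 gx1] [Ux2 gx2]; rewrite leNgt; apply/negP => /rat_in_itvoo[q].
    rewrite in_itv/= => /andP[q1 q2].
    have [] := hU (Some (m, i, q)) x1 x2 Ux1 Ux2; first by split=> //; exact: ltW.
    by move=> _; rewrite leNgt q2.
  by apply/eqP; rewrite eq_le !le.
apply: cvg_EFin; first exact: nearW.
exact: gx.
Qed.

End main.

Theorem theoremC (R : realType) (X : pointedMetricType R) (f : X -> X)
    (mu : {measure set (borel X) -> \bar R}) :
  compact [set: X] -> continuous f -> (mu [set: borel X] < +oo)%E ->
  ((exists nu0 : {measure set (borel X) -> \bar R}, gen_mu_physical f mu nu0)
     <-> (0 < mu [set x | eta_x f x [set: X] = 1%E])%E) /\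
  (ergodic f mu -> (0 < mu [set x | eta_x f x [set: X] = 1%E])%E ->
     exists nu0 : {measure set (borel X) -> \bar R}, mu_physical f mu nu0).
Proof.
move=> cX cf mufin.
have -> : [set x | eta_x f x [set: X] = 1%E] = [set x | generic f x].
  by apply/seteqP; split=> x /=; rewrite eta_eq1P.
split; last exact: mu_physical_exists.
split=> [[nu0]|]; first exact: gen_mu_physical_generic.
exact: gen_mu_physical_exists.
Qed.
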